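(* Let $N\ge 1$, let $\varepsilon>0$, let $L$ be a compact subset of $\mathbb{B}_N$, let $g\in\mathcal{B}_0(\mathbb{B}_N)$, and let $\varphi\in C(\mathbb{S}_N)$. There exist a measurable set $E\subset\mathbb{S}_N$ with $m_N(E)\ge 1-\varepsilon$ and a polynomial $f\in\mathcal{B}_0(\mathbb{B}_N)$, such that (i) $\|f-g\|_{\mathcal{B}(\mathbb{B}_N)}<\varepsilon$; (ii) $\|f-\varphi\|_{\infty,E}<\varepsilon$.
   Context: $\mathbb{B}_N=\{z\in\mathbb{C}^N:|z|<1\}$ is the open unit ball (Euclidean norm), $\mathbb{S}_N$ the unit sphere of $\mathbb{C}^N$, and $m_N$ the normalised Lebesgue measure on $\mathbb{S}_N$. $C(\mathbb{S}_N)$ is the space of continuous complex-valued functions on $\mathbb{S}_N$, and $\|h\|_{\infty,E}=\sup_{z\in E}|h(z)|$. For $f$ holomorphic on $\mathbb{B}_N$, $\mathcal{R}(f)=\sum_{k=1}^N z_k\frac{\partial f}{\partial z_k}$. The Bloch space $\mathcal{B}(\mathbb{B}_N)$ is the Banach space of holomorphic $f$ on $\mathbb{B}_N$ with $\|f\|_{\mathcal{B}(\mathbb{B}_N)}:=|f(0)|+\sup_{z\in\mathbb{B}_N}(1-|z|^2)|\mathcal{R}(f)(z)|<\infty$. The little Bloch space $\mathcal{B}_0(\mathbb{B}_N)$ is the closure of the set of all (holomorphic) polynomials in $\mathcal{B}(\mathbb{B}_N)$. *)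

(* Defs.v *)
From HB Require Import structures.
From mathcomp Require Import all_boot all_order all_algebra.
From mathcomp Require Import all_classical all_reals all_analysis.
From mathcomp Require Import complex.
(* Not imported: its notations clash with those of mathcomp-analysis. *)
From mathcomp Require mpoly.

Set Implicit Arguments.
Unset Strict Implicit.
Unset Printing Implicit Defensive.

Import Order.TTheory GRing.Theory Num.Theory.
Import numFieldNormedType.Exports.

Local Open Scope classical_set_scope.
Local Open Scope ring_scope.
Local Open Scope complex_scope.

(* Declared as a [numFieldType] so that scalars and row vectors of scalars get
   the canonical topological and normed structures of mathcomp-analysis. *)
Definition Cplx (R : realType) : numFieldType := R[i].

(* The library modulus on [R[i]] takes values in [R[i]]; [cabs] is real. *)
Definition cabs {R : realType} (x : Cplx R) : R := ComplexField.Normc.normc x.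

(* The library norm on ['rV[Cplx R]_N] is the sup norm.  It induces the usual
   topology of C^N, hence the same open and compact sets, continuity and
   differentiability, but the ball and the sphere must use the Euclidean norm. *)
Definition enorm {R : realType} {N : nat} (z : 'rV[Cplx R]_N) : R :=
  Num.sqrt (\sum_(k < N) cabs (z ord0 k) ^+ 2).

Definition unit_ball (R : realType) (N : nat) : set 'rV[Cplx R]_N :=
  [set z | enorm z < 1].
Arguments unit_ball : clear implicits.

Definition unit_sphere (R : realType) (N : nat) : set 'rV[Cplx R]_N :=
  [set z | enorm z = 1].
Arguments unit_sphere : clear implicits.

(* Functions on the ball or on the sphere are total functions on C^N whose
   values off the ball, respectively off the sphere, play no role.  Here
   [differentiable] is Frechet differentiability over the field [Cplx R]. *)
Definition holomorphic_on_ball {R : realType} {N : nat}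
    (f : 'rV[Cplx R]_N -> Cplx R) : Prop :=
  forall z, unit_ball R N z -> differentiable f z.

(* [derive f z (delta_mx ord0 k)] is the complex partial derivative of [f] with
   respect to the k-th coordinate. *)
Definition radial_derivative {R : realType} {N : nat}
    (f : 'rV[Cplx R]_N -> Cplx R) (z : 'rV[Cplx R]_N) : Cplx R :=
  \sum_(k < N) z ord0 k * derive f z (delta_mx ord0 k).

Definition bloch_norm {R : realType} {N : nat}
    (f : 'rV[Cplx R]_N -> Cplx R) : \bar R :=
  ((cabs (f 0))%:E +
   ereal_sup [set ((1 - enorm z ^+ 2) * cabs (radial_derivative f z))%:E
             | z in unit_ball R N])%E.

Definition bloch {R : realType} {N : nat}
    (f : 'rV[Cplx R]_N -> Cplx R) : Prop :=
  holomorphic_on_ball f /\ (bloch_norm f < +oo)%E.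

Definition is_poly {R : realType} {N : nat}
    (f : 'rV[Cplx R]_N -> Cplx R) : Prop :=
  exists p : mpoly.mpoly N (Cplx R),
    forall z, f z = mpoly.meval (fun k => z ord0 k) p.

(* Membership in the closure of the polynomials in the Bloch space. *)
Definition little_bloch {R : realType} {N : nat}
    (f : 'rV[Cplx R]_N -> Cplx R) : Prop :=
  bloch f /\
  forall e : R, 0 < e ->
    exists p, [/\ is_poly p, bloch p & (bloch_norm (p \- f)%R < e%:E)%E].

Definition sup_norm_on {R : realType} {N : nat} (E : set 'rV[Cplx R]_N)
    (h : 'rV[Cplx R]_N -> Cplx R) : \bar R :=
  ereal_sup [set (cabs (h z))%:E | z in E].

(* Lebesgue measure on R^n: the n-fold product of [lebesgue_measure]. *)
Fixpoint lebesgue_measure_tuple (R : realType) (n : nat) :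
    set (n.-tuple (measurableTypeR R)) -> \bar R :=
  match n return set (n.-tuple (measurableTypeR R)) -> \bar R with
  | 0 => fun A => \d_([tuple]) A
  | n'.+1 => fun A =>
      (lebesgue_measure \x @lebesgue_measure_tuple R n')%E
        [set p : measurableTypeR R * n'.-tuple (measurableTypeR R) |
          A (cons_tuple p.1 p.2)]
  end.

(* The identification of R^(2N) with C^N: real parts first, then imaginary
   parts. *)
Definition tuple_to_cvec {R : realType} {N : nat}
    (t : (N + N).-tuple (measurableTypeR R)) : 'rV[Cplx R]_N :=
  \row_(k < N) ((tnth t (lshift N k) : R) +i* (tnth t (rshift N k) : R)).

Definition volume {R : realType} {N : nat} (A : set 'rV[Cplx R]_N) : \bar R :=
  lebesgue_measure_tuple (tuple_to_cvec @^-1` A).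

Definition radial_cone {R : realType} {N : nat} (A : set 'rV[Cplx R]_N) :
    set 'rV[Cplx R]_N :=
  [set z | exists (r : R) (w : 'rV[Cplx R]_N),
     [/\ 0 < r < 1, A w & z = (r%:C : Cplx R) *: w]].

(* In polar coordinates the surface measure of a Borel subset [A] of the sphere
   of R^(2N) is 2N times the volume of the cone over [A]; the factor 2N cancels
   in the normalisation. *)
Definition sphere_measure {R : realType} {N : nat}
    (A : set 'rV[Cplx R]_N) : \bar R :=
  (volume (radial_cone A) * ((fine (volume (unit_ball R N)))^-1)%:E)%E.

Definition borel_set {R : realType} {N : nat} (A : set 'rV[Cplx R]_N) : Prop :=
  <<s [set U : set 'rV[Cplx R]_N | open U] >> A.

(* Main.v *)
(** Write [w = f - psi] on the sphere, where [f] is the current polynomial and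
    [psi = phi - p] with [p] a polynomial close to [g].  Add to [f] a sum of peaks
    [a c_j ((u + u^2)/2)^n], [u = <z, zeta_j>], with [c_j] in [{1, i, -1, -i}] and
    [zeta_j] running through the points of a net of mesh of order [n^(-1/2)] where
    [|w|] is not small yet.  Near the sphere such a peak is a Gaussian of width
    [n^(-1/2)], so the sum of the moduli of the peaks is bounded, and some peak is
    bounded below at each point, uniformly in [n]; if [n] at least doubles from one
    step to the next, the Bloch norms of the increments do not accumulate.  A
    logarithmic potential of [w] is nonnegative and strictly superharmonic away from
    [0], so averaging over the phases strictly decreases its integral over the
    sphere as long as [4 t <= |w| <= M] on a set that is not small, and some choice
    of phases does as well as the average.  Hence the procedure stops, and
    [|w| > M] only on a small set by Markov's inequality. *)
From HB Require Import structures.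
From mathcomp Require Import ring lra zify.
Require Import Defs.
From mathcomp Require Import all_boot all_order all_algebra.
From mathcomp Require Import all_classical all_reals all_analysis.
From mathcomp Require Import complex.
From mathcomp Require mpoly.
Import Order.TTheory GRing.Theory Num.Theory.
Import numFieldNormedType.Exports.
Local Open Scope classical_set_scope.
Local Open Scope ring_scope.

(** * Lebesgue measure on tuples *)

(** The obstacle is to move [f] by a fixed amount on most of the sphere at small Bloch cost. On the
    sphere of radius [rho], a block of exponent [n] and total modulus [b0] costs at most
    [2 b0 (1 - rho) n rho^n], a bump concentrated at [1 - rho ~ 1/n]; so blocks of widely separated
    exponents cost [O(b0)] together, however many there are. Such blocks oscillate freely and cannot
    be aimed at a given correction. A mean-square functional does not decrease either: averaging
    over phases adds the energy of the block to that of [w]. The function [ln |w|] is neutral, being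
    harmonic off [0]; subtracting a strictly subharmonic term from it creates a gain of order
    [|q|^2 / (1 + |w|^2)^2] for each peak value [q]. The subtracted term is the smaller one at
    infinity, so the potential still bounds the set where [|w|] is large. Four phases replace the
    full circle because the product of the four numbers [|w + i^j q|^2] is explicit, so that only
    polynomial inequalities remain. The threshold [M] depends on the initial integral alone and is
    fixed before the iteration; hence every step gains the same amount. *)

Definition tuple_box {R : realType} (n : nat) (r : R) :
    set (n.-tuple (measurableTypeR R)) :=
  [set t | forall i, - r <= (tnth t i : R) <= r].

Lemma measurable_tuple_box (R : realType) (n : nat) (r : R) :
  measurable (tuple_box n r).
Proof.
rewrite (_ : tuple_box n r = \bigcap_(i in [set: 'I_n])
    ((fun t : n.-tuple (measurableTypeR R) => tnth t i) @^-1` `[- r, r])).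
  apply: fin_bigcap_measurable => [|i _]; first exact: finite_finset.
  by rewrite -[X in measurable X]setTI; apply: measurable_tnth.
by apply/seteqP; split=> t /= tP i; [move=> _|]; have := tP i;
  rewrite /= ?in_itv //=; apply.
Qed.

Section cons_measure.
Context {R : realType} {n : nat}.
Variable mu : {sigma_finite_measure set (n.-tuple (measurableTypeR R)) -> \bar R}.

Let consp (p : measurableTypeR R * n.-tuple (measurableTypeR R)) :
  n.+1.-tuple (measurableTypeR R) := cons_tuple p.1 p.2.

Let mconsp : measurable_fun setT consp.
Proof. by apply: measurable_cons. Qed.

(** One stage of the recursion defining [lebesgue_measure_tuple], written as a pushforward so that
    it can carry a measure structure. *)
Definition cons_measure : set (n.+1.-tuple (measurableTypeR R)) -> \bar R :=
  pushforward (lebesgue_measure \x mu)%E consp.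

Let cons_measure0 : cons_measure set0 = 0%E.
Proof. by rewrite /cons_measure /pushforward preimage_set0 measure0. Qed.

Let cons_measure_ge0 A : (0 <= cons_measure A)%E.
Proof. exact: measure_ge0. Qed.

Let cons_measure_sigma_additive : semi_sigma_additive cons_measure.
Proof.
have mpre F : measurable F -> measurable (consp @^-1` F).
  by move=> mF; rewrite -[X in measurable X]setTI; exact: mconsp.
move=> F mF tF mUF; rewrite /cons_measure /pushforward preimage_bigcup.
apply: measure_semi_sigma_additive => [k||]; first exact: mpre.
- apply/trivIsetP => /= i j _ _ ij; rewrite -preimage_setI.
  by move/trivIsetP : tF => /(_ _ _ _ _ ij) ->//; rewrite preimage_set0.
- by rewrite -preimage_bigcup; exact: mpre.
Qed.

HB.instance Definition _ := @isMeasure.Build _ _ _ cons_measure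
  cons_measure0 cons_measure_ge0 cons_measure_sigma_additive.

Lemma cons_measure_box (r : R) : 0 <= r ->
  (cons_measure (tuple_box n.+1 r) = (r *+ 2)%:E * mu (tuple_box n r))%E.
Proof.
move=> r0.

have E : consp @^-1` tuple_box n.+1 r = ((`[- r, r]%classic : set (measurableTypeR R)) `*` tuple_box n r).
  apply/seteqP; split=> -[x t] /=.
    move=> H; split; first by have := H ord0; rewrite in_itv.
    by move=> i; have := H (lift ord0 i); rewrite /consp /= tnthS.
  move=> [xr tr] i; rewrite /consp /=.
  have [->|i0] := eqVneq i ord0; first by have := xr; rewrite /= in_itv.
  case: (unliftP ord0 i) i0 => [j ->|->]; last by rewrite eqxx.
  by rewrite tnthS => _; exact: tr.
apply: (etrans (congr1 (lebesgue_measure \x mu)%E E)).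
rewrite [LHS]product_measure1E //; last exact: measurable_tuple_box.
congr (_ * _)%E.
apply: (etrans (lebesgue_measure_itv _)); rewrite /= lte_fin.
case: ltP => [_|]; first by rewrite -EFinD opprK mulr2n.
by move=> rN; have -> : r = 0; [lra|rewrite mul0rn].
Qed.

End cons_measure.

Lemma tuple_box_sigma_finite (R : realType) (n : nat)
    (mu : {measure set (n.-tuple (measurableTypeR R)) -> \bar R}) :
  (forall r : R, 0 <= r -> mu (tuple_box n r) = ((r *+ 2) ^+ n)%:E) ->
  sigma_finite setT mu.
Proof.
move=> muE; exists (fun k => tuple_box n k%:R) => [|k]; last first.
  by split; [exact: measurable_tuple_box|rewrite muE // ltry].
apply/esym/seteqP; split=> // t _.
pose b : R := \sum_(i < n) `|tnth t i : R|.
exists (Num.trunc b).+1 => // i.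
rewrite -ler_norml.
apply: (@le_trans _ _ b); last exact/ltW/truncnS_gt.
by rewrite /b (bigD1 i) //= lerDl sumr_ge0.
Qed.

(** A product measure asks for a sigma-finite second factor; the volume of cubes is carried through
    the induction to supply this at each stage. *)
Lemma lebesgue_measure_tupleE (R : realType) (n : nat) :
  exists2 mu : {sigma_finite_measure set (n.-tuple (measurableTypeR R)) -> \bar R},
    mu = @lebesgue_measure_tuple R n :> (set _ -> \bar R) &
    forall r : R, 0 <= r -> mu (tuple_box n r) = ((r *+ 2) ^+ n)%:E.
Proof.
elim: n => [|n [mu muE muB]].
  exists (\d_([tuple] : 0.-tuple (measurableTypeR R))) => // r r0.
  by rewrite expr0 /= /dirac indicE mem_set // => -[].
have cB (r : R) : 0 <= r -> cons_measure mu (tuple_box n.+1 r) = ((r *+ 2) ^+ n.+1)%:E.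
  by move=> r0; rewrite cons_measure_box // muB // -EFinM exprS.
pose sf := tuple_box_sigma_finite _ _ (cons_measure mu) cB.
pose m := HB.pack_for (@sigma_finite_measure _ (n.+1.-tuple (measurableTypeR R)) R)
  (cons_measure mu) (Measure_isSigmaFinite.Build _ _ _ (cons_measure mu) sf).
exists m => //; apply/funext => A /=.
by rewrite /m /= /cons_measure /pushforward muE.
Qed.

(** * Modulus and Euclidean norm *)

Section cabs_theory.
Context {R : realType}.
Implicit Types x y : Cplx R.

Definition cre (x : Cplx R) : R := complex.Re x.
Definition cim (x : Cplx R) : R := complex.Im x.
Definition ccj (x : Cplx R) : Cplx R := Complex (cre x) (- cim x).
Definition cofr (r : R) : Cplx R := Complex r 0.

Lemma cre_is_additive : {morph cre : x y / x + y}. Proof. by case=> a b [c d]. Qed.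
Lemma cim_is_additive : {morph cim : x y / x + y}. Proof. by case=> a b [c d]. Qed.
Lemma creN x : cre (- x) = - cre x. Proof. by case: x. Qed.
Lemma cimN x : cim (- x) = - cim x. Proof. by case: x. Qed.
Lemma creM x y : cre (x * y) = cre x * cre y - cim x * cim y.
Proof. by case: x y => a b [c d]. Qed.
Lemma cimM x y : cim (x * y) = cre x * cim y + cim x * cre y.
Proof. by case: x y => a b [c d]. Qed.

Lemma cre1 : cre 1 = 1. Proof. by []. Qed.
Lemma cim1 : cim 1 = 0. Proof. by []. Qed.
Lemma cre_cofrM (r : R) x : cre (cofr r * x) = r * cre x.
Proof. by rewrite creM /= mul0r subr0. Qed.
Lemma cim_cofrM (r : R) x : cim (cofr r * x) = r * cim x.
Proof. by rewrite cimM /= mul0r addr0. Qed.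

Lemma cre_sum (I : Type) (s : seq I) (F : I -> Cplx R) :
  cre (\sum_(i <- s) F i) = \sum_(i <- s) cre (F i).
Proof.
elim: s => [|a s IH]; first by rewrite !big_nil.
by rewrite !big_cons cre_is_additive IH.
Qed.

Lemma cabs_sqr x : cabs x ^+ 2 = cre x ^+ 2 + cim x ^+ 2.
Proof. by case: x => a b; rewrite /cabs /= sqr_sqrtr // addr_ge0 // sqr_ge0. Qed.

Lemma cabs_ge0 x : 0 <= cabs x.
Proof. by case: x => a b; exact: sqrtr_ge0. Qed.

Lemma cabs0 : cabs (0 : Cplx R) = 0. Proof. exact: ComplexField.Normc.normc0. Qed.
Lemma cabs1 : cabs (1 : Cplx R) = 1. Proof. exact: ComplexField.Normc.normc1. Qed.
Lemma cabsM x y : cabs (x * y) = cabs x * cabs y.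
Proof. exact: ComplexField.Normc.normcM. Qed.
Lemma cabsD x y : cabs (x + y) <= cabs x + cabs y.
Proof. exact: le_normcD. Qed.
Lemma cabsN x : cabs (- x) = cabs x. Proof. exact: normcN. Qed.
Lemma cabs_distC x y : cabs (x - y) = cabs (y - x).
Proof. by rewrite -cabsN opprB. Qed.
Lemma cabs_sub_ge x y : cabs x - cabs y <= cabs (x - y).
Proof. by rewrite lerBlDr -{1}(subrK y x) cabsD. Qed.
Lemma cabs0_eq0 x : cabs x = 0 -> x = 0.
Proof. exact: ComplexField.Normc.eq0_normc. Qed.
Lemma cabsX x n : cabs (x ^+ n) = cabs x ^+ n.
Proof. by elim: n => [|n IH]; rewrite ?expr0 ?cabs1 // !exprS cabsM IH. Qed.
Lemma cabs_cofr (r : R) : cabs (cofr r) = `|r|.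
Proof. by rewrite /cabs /= expr0n /= addr0 sqrtr_sqr. Qed.
Lemma cabs_cofr_ge0 (r : R) : 0 <= r -> cabs (cofr r) = r.
Proof. by move=> r0; rewrite cabs_cofr ger0_norm. Qed.
Lemma cabs_sum (I : Type) (s : seq I) (F : I -> Cplx R) :
  cabs (\sum_(i <- s) F i) <= \sum_(i <- s) cabs (F i).
Proof.
elim: s => [|a s IH]; first by rewrite !big_nil cabs0.
by rewrite !big_cons (le_trans (cabsD _ _)) // lerD2l.
Qed.
Lemma cabs_cre x : `|cre x| <= cabs x.
Proof.
rewrite -(@ler_pXn2r _ 2) ?nnegrE ?cabs_ge0 // cabs_sqr real_normK ?num_real //.
by rewrite lerDl sqr_ge0.
Qed.
Lemma cabs_cim x : `|cim x| <= cabs x.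
Proof.
rewrite -(@ler_pXn2r _ 2) ?nnegrE ?cabs_ge0 // cabs_sqr real_normK ?num_real //.
by rewrite lerDr sqr_ge0.
Qed.
Lemma cabs_le_reim x : cabs x <= `|cre x| + `|cim x|.
Proof.
rewrite -(@ler_pXn2r _ 2) ?nnegrE ?cabs_ge0 ?addr_ge0 // cabs_sqr.
rewrite -(real_normK (num_real (cre x))) -(real_normK (num_real (cim x))).
have := normr_ge0 (cre x); have := normr_ge0 (cim x); nra.
Qed.
Lemma normr_cabs x : `|x| = cofr (cabs x).
Proof. by []. Qed.
Lemma ltc_cofr (a b : R) : (cofr a < cofr b) = (a < b).
Proof. exact: ltcR. Qed.
Lemma cofrM (a b : R) : cofr (a * b) = cofr a * cofr b.
Proof. by rewrite /cofr; apply/eqP; rewrite eq_complex /= !mul0r !mulr0 subr0 addr0 !eqxx. Qed.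
Lemma cabs_ccj x : cabs (ccj x) = cabs x.
Proof. by case: x => a b; rewrite /cabs /= sqrrN. Qed.
End cabs_theory.

Section enorm_theory.
Context {R : realType} {N : nat}.
Implicit Types z w : 'rV[Cplx R]_N.

Definition inner z w : Cplx R := \sum_(k < N) z ord0 k * ccj (w ord0 k).

Lemma enorm_ge0 z : 0 <= enorm z. Proof. exact: sqrtr_ge0. Qed.
Lemma enorm_sqr z : enorm z ^+ 2 = \sum_(k < N) cabs (z ord0 k) ^+ 2.
Proof. by rewrite sqr_sqrtr // sumr_ge0 // => k _; rewrite sqr_ge0. Qed.

Lemma enormZ (c : Cplx R) z : enorm (c *: z) = cabs c * enorm z.
Proof.
apply/eqP; rewrite -(@eqrXn2 _ 2) // ?mulr_ge0 ?enorm_ge0 ?cabs_ge0 //.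
rewrite exprMn !enorm_sqr mulr_sumr; apply/eqP/eq_bigr => k _.
by rewrite mxE cabsM exprMn.
Qed.

Lemma enormN z : enorm (- z) = enorm z.
Proof. by rewrite /enorm; congr Num.sqrt; apply: eq_bigr => k _; rewrite mxE cabsN. Qed.
Lemma enorm0 : enorm (0 : 'rV[Cplx R]_N) = 0.
Proof. by rewrite -(scale0r (0 : 'rV[Cplx R]_N)) enormZ cabs0 mul0r. Qed.
Lemma enorm_distC z w : enorm (z - w) = enorm (w - z).
Proof. by rewrite -enormN opprB. Qed.

Lemma cabs_coord_le z k : cabs (z ord0 k) <= enorm z.
Proof.
rewrite -(@ler_pXn2r _ 2) ?nnegrE ?cabs_ge0 ?enorm_ge0 // enorm_sqr.
by rewrite (bigD1 k) //= lerDl sumr_ge0 // => i _; rewrite sqr_ge0.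
Qed.

Lemma enorm0_eq0 z : enorm z = 0 -> z = 0.
Proof.
move=> z0; apply/rowP => k; rewrite mxE; apply: cabs0_eq0; apply/eqP.
by rewrite eq_le cabs_ge0 andbT -z0 cabs_coord_le.
Qed.

Lemma enormB_sqr z w :
  enorm (z - w) ^+ 2 = enorm z ^+ 2 + enorm w ^+ 2 - cre (inner z w) *+ 2.
Proof.
rewrite !enorm_sqr /inner cre_sum -sumrMnl -sumrN -!big_split /=.
apply: eq_bigr => k _; rewrite !mxE !cabs_sqr !cre_is_additive !cim_is_additive.
rewrite creN cimN creM /=; ring.
Qed.

Lemma innerZl (c : Cplx R) z w : inner (c *: z) w = c * inner z w.
Proof. by rewrite /inner mulr_sumr; apply: eq_bigr => k _; rewrite mxE mulrA. Qed.

Lemma cre_inner_le z w : enorm z = 1 -> enorm w = 1 -> cre (inner z w) <= 1.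
Proof.
move=> z1 w1; have := sqr_ge0 (enorm (z - w)).
rewrite enormB_sqr z1 w1 expr1n -mulr_natr; lra.
Qed.

(** Multiplying [z] by the conjugate phase of the inner product makes that product real and
    nonnegative, and its real part is bounded by expanding [|z - w|^2]. *)
Lemma cabs_inner_le1 z w : enorm z = 1 -> enorm w = 1 -> cabs (inner z w) <= 1.
Proof.
move=> z1 w1; have [/eqP->|nz] := boolP (cabs (inner z w) == 0); first by [].
set v := inner z w in nz *; have v0 : 0 < cabs v by rewrite lt0r nz cabs_ge0.
pose c : Cplx R := cofr (cabs v)^-1 * ccj v.
have c1 : cabs c = 1.
  by rewrite cabsM cabs_cofr_ge0 ?invr_ge0 ?cabs_ge0 // cabs_ccj mulVf.
have -> : cabs v = cre (inner (c *: z) w).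
  rewrite innerZl -/v !creM !cimM /=; apply: (mulfI nz).
  rewrite -expr2 cabs_sqr; field.
  exact: nz.
by apply: cre_inner_le => //; rewrite enormZ c1 z1 mul1r.
Qed.

Lemma cabs_inner_le z w : cabs (inner z w) <= enorm z * enorm w.
Proof.
have [z0|nz] := eqVneq (enorm z) 0.
  rewrite (enorm0_eq0 _ z0) enorm0 mul0r /inner big1 ?cabs0 // => k _.
  by rewrite mxE mul0r.
have [w0|nw] := eqVneq (enorm w) 0.
  rewrite (enorm0_eq0 _ w0) enorm0 mulr0 /inner big1 ?cabs0 // => k _.
  by rewrite mxE /ccj /cre /cim /= oppr0 mulr0.
have zp : 0 < enorm z by rewrite lt0r nz enorm_ge0.
have wp : 0 < enorm w by rewrite lt0r nw enorm_ge0.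
pose z' := cofr (enorm z)^-1 *: z; pose w' := cofr (enorm w)^-1 *: w.
have z'1 : enorm z' = 1 by rewrite enormZ cabs_cofr_ge0 ?invr_ge0 ?enorm_ge0 // mulVf.
have w'1 : enorm w' = 1 by rewrite enormZ cabs_cofr_ge0 ?invr_ge0 ?enorm_ge0 // mulVf.
have := @cabs_inner_le1 _ _ z'1 w'1.
have -> : inner z' w' = cofr (enorm z)^-1 * cofr (enorm w)^-1 * inner z w.
  rewrite innerZl -mulrA; congr (_ * _); rewrite /inner mulr_sumr.
  apply: eq_bigr => k _; rewrite mxE mulrCA; congr (_ * _).
  case: (w ord0 k) => a b; rewrite /ccj /cofr /cre /cim.
  by apply/eqP; rewrite eq_complex /= !mul0r !subr0 !addr0 mulrN !eqxx.
rewrite !cabsM !cabs_cofr_ge0 ?invr_ge0 ?enorm_ge0 //.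
by rewrite -invfM mulrC ler_pdivrMr ?mul1r ?mulr_gt0.
Qed.

Lemma enormD z w : enorm (z + w) <= enorm z + enorm w.
Proof.
rewrite -(@ler_pXn2r _ 2) ?nnegrE ?addr_ge0 ?enorm_ge0 //.
rewrite -{1}(opprK w) enormB_sqr enormN -mulr_natr.
have := cabs_inner_le z (- w); rewrite enormN.
have := cabs_cre (inner z (- w)); rewrite ler_norml => /andP[h1 h2] h3.
nra.
Qed.

Lemma enormB z w : enorm (z - w) <= enorm z + enorm w.
Proof. by rewrite -(enormN w) enormD. Qed.

Lemma enorm_sub_ge z w : enorm z - enorm w <= enorm (z - w).
Proof. by rewrite lerBlDr -{1}(subrK w z) enormD. Qed.

Lemma enorm_le_sum z : enorm z <= \sum_(k < N) cabs (z ord0 k).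
Proof.
have s0 : 0 <= \sum_(k < N) cabs (z ord0 k) by apply: sumr_ge0 => k _; exact: cabs_ge0.
rewrite -(@ler_pXn2r _ 2) ?nnegrE ?enorm_ge0 // enorm_sqr expr2 mulr_suml.
apply: ler_sum => k _; rewrite expr2 ler_wpM2l ?cabs_ge0 //.
by rewrite (bigD1 k) //= lerDl sumr_ge0 // => i _; exact: cabs_ge0.
Qed.

(** Passage from sup-norm neighbourhoods, whose radii lie in [Cplx R] and are real because they are
    positive, to Euclidean balls with radii in [R]. *)
Lemma nbhs_enorm z (U : set 'rV[Cplx R]_N) :
  nbhs z U <-> exists2 r : R, 0 < r & forall y, enorm (y - z) < r -> U y.
Proof.
split.
  move=> /nbhs_ballP[e /= e0 eU].
  have er : e = cofr (cre e).
    by case: e e0 {eU} => a b; rewrite ltcE /= /cofr /cre /= => /andP[/eqP -> _].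
  exists (cre e); first by rewrite -ltc_cofr -er.
  move=> y yz; apply: eU; split=> // i j; rewrite ord1 /ball /= er normr_cabs ltc_cofr.
  apply: le_lt_trans yz; rewrite enorm_distC.
  by apply: le_trans (cabs_coord_le _ j); rewrite !mxE.
move=> [r r0 rU]; apply/nbhs_ballP.
(* With [N.+1] instead of [N], the [N] coordinates sum to strictly less than [r], also for
   [N = 0]. *)
have e0 : 0 < r / N.+1%:R by rewrite divr_gt0.
exists (cofr (r / N.+1%:R)); first by rewrite /= -[0]/(cofr 0) ltc_cofr.
move=> y yz; apply: rU; apply: le_lt_trans (enorm_le_sum _) _.
apply: (@le_lt_trans _ _ (\sum_(k < N) (r / N.+1%:R))).
  apply: ler_sum => k _; have := yz.2 ord0 k; rewrite /ball /= normr_cabs ltc_cofr.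
  by rewrite cabs_distC !mxE => /ltW.
rewrite sumr_const card_ord -[_ *+ N]mulr_natr mulrAC -mulrA -[ltRHS]mulr1 ltr_pM2l //.
by rewrite ltr_pdivrMr // mul1r ltr_nat.
Qed.

End enorm_theory.

Lemma nbhs_cabs {R : realType} (x : Cplx R) (U : set (Cplx R)) :
  nbhs x U <-> exists2 r : R, 0 < r & forall y, cabs (y - x) < r -> U y.
Proof.
split.
  move=> /nbhs_ballP[e /= e0 eU].
  have er : e = cofr (cre e).
    by case: e e0 {eU} => a b; rewrite ltcE /= /cofr /cre /= => /andP[/eqP -> _].
  exists (cre e); first by rewrite -ltc_cofr -er.
  by move=> y yz; apply: eU; rewrite /ball /= er normr_cabs ltc_cofr cabs_distC.
move=> [r r0 rU]; apply/nbhs_ballP.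
exists (cofr r); first by rewrite /= -[0]/(cofr 0) ltc_cofr.
by move=> y; rewrite /ball /= normr_cabs ltc_cofr cabs_distC; exact: rU.
Qed.

(** * Polar coordinates *)

Section measurability.
Context {R : realType} {N : nat}.
Let Om := (N + N).-tuple (measurableTypeR R).

Let dbox (kc : nat * {ffun 'I_(N + N) -> int}) : set Om :=
  [set t | forall i, (kc.2 i)%:~R <= (tnth t i : R) * kc.1.+1%:R < (kc.2 i)%:~R + 1].

Let measurable_dbox kc : measurable (dbox kc).
Proof.
rewrite (_ : dbox kc = \bigcap_(i in [set: 'I_(N + N)])
    ((fun t : Om => tnth t i) @^-1`
      `[(kc.2 i)%:~R / kc.1.+1%:R, ((kc.2 i)%:~R + 1) / kc.1.+1%:R[)).
  apply: fin_bigcap_measurable => [|i _]; first exact: finite_finset.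
  by rewrite -[X in measurable X]setTI; apply: measurable_tnth.
have k0 : 0 < kc.1.+1%:R :> R by [].
by apply/seteqP; split=> t /= tP i; [move=> _|]; have := tP i;
  rewrite /= ?in_itv /= ler_pdivrMr // ltr_pdivlMr //; apply.
Qed.

Lemma tuple_to_cvec_dist (s t : Om) (r : R) :
  (forall i, `|(tnth s i : R) - tnth t i| <= r) ->
  enorm (tuple_to_cvec s - tuple_to_cvec t) <= r *+ (N + N).
Proof.
move=> str; apply: le_trans (enorm_le_sum _) _.
have -> : r *+ (N + N) = \sum_(k < N) (r + r).
  by rewrite sumr_const card_ord mulrnDr mulrnDl.
apply: ler_sum => k _; rewrite !mxE; apply: le_trans (cabs_le_reim _) _.
by apply: lerD; [exact: (str (lshift N k))|exact: (str (rshift N k))].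
Qed.

(** An open set is the union of the countably many half-open grid cubes, of all meshes [1/(k+1)],
    that it contains. *)
Lemma measurable_preimage_open (U : set 'rV[Cplx R]_N) :
  open U -> measurable (@tuple_to_cvec R N @^-1` U).
Proof.
move=> oU.
rewrite (_ : _ @^-1` U = \bigcup_kc
    (if `[< dbox kc `<=` @tuple_to_cvec R N @^-1` U >] then dbox kc else set0)).
  apply: countable_bigcupT_measurable => [|kc]; first exact: countableP.
  by case: asboolP => _; [exact: measurable_dbox|exact: measurable0].
apply/seteqP; split=> t /=; last first.
  by case=> kc _; case: asboolP => // + ; apply.
move=> Ut; have /nbhs_enorm[r r0 rU] : nbhs (tuple_to_cvec t) U.
  exact: open_nbhs_nbhs.
(* A cube of side [1/(k+1)] has Euclidean diameter at most [2N/(k+1)], which this choice makes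
   smaller than [r]. *)
pose k := Num.trunc ((N + N).+1%:R / r).
have kr : (N + N).+1%:R / r < k.+1%:R by exact: truncnS_gt.
pose c : {ffun 'I_(N + N) -> int} := [ffun i => Num.floor ((tnth t i : R) * k.+1%:R)].
have tc : dbox (k, c) t.
  by move=> i; rewrite /= ffunE floor_le /= -[X in _ + X]/(1%:~R) -intrD floorD1_gt.
exists (k, c) => //; case: asboolP => // -[].
move=> s sc; apply: rU; apply: (@le_lt_trans _ _ (k.+1%:R^-1 *+ (N + N))).
  apply: tuple_to_cvec_dist => i.
  have k0 : 0 < k.+1%:R :> R by [].
  rewrite -div1r ler_pdivlMr // -[X in _ * X]gtr0_norm // -normrM mulrBl.
  have /andP[] := tc i; have /andP[] := sc i => /=.
  move=> *; rewrite ler_norml; lra.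
rewrite -[_ *+ (N + N)]mulr_natl ltr_pdivrMr // mulrC.
rewrite ltr_pdivrMr // in kr.
by apply: le_lt_trans kr; rewrite ler_nat.
Qed.

Definition sproj (z : 'rV[Cplx R]_N) : 'rV[Cplx R]_N := cofr (enorm z)^-1 *: z.

Lemma enorm_sproj z : enorm z != 0 -> enorm (sproj z) = 1.
Proof. by move=> z0; rewrite enormZ cabs_cofr_ge0 ?invr_ge0 ?enorm_ge0 // mulVf. Qed.

Lemma sproj_scale (r : R) z : 0 < r -> enorm z = 1 -> sproj (cofr r *: z) = z.
Proof.
move=> r0 z1; rewrite /sproj enormZ z1 mulr1 cabs_cofr_ge0 ?ltW // scalerA.
by rewrite -cofrM mulVf ?gt_eqF // -[cofr 1]/(1 : Cplx R) scale1r.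
Qed.

Lemma sprojK z : enorm z != 0 -> cofr (enorm z) *: sproj z = z.
Proof.
by move=> z0; rewrite /sproj scalerA -cofrM divff // -[cofr 1]/(1 : Cplx R) scale1r.
Qed.

Lemma sproj_dist y z : enorm z != 0 -> enorm y != 0 ->
  enorm (sproj y - sproj z) <= enorm (y - z) / enorm z *+ 2.
Proof.
move=> z0 y0.
have zp : 0 < enorm z by rewrite lt0r z0 enorm_ge0.
have yp : 0 < enorm y by rewrite lt0r y0 enorm_ge0.
(* Splits the difference into a change of length and a change of vector; each part has norm at most
   [|y - z| / |z|]. *)
have -> : sproj y - sproj z =
    cofr ((enorm z - enorm y) / enorm z) *: sproj y + cofr (enorm z)^-1 *: (y - z).
  rewrite scalerBr -/(sproj z) addrA; congr (_ - _).
  rewrite (_ : _ *: y = cofr (enorm y / enorm z) *: sproj y); last first.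
    by rewrite -[in LHS](sprojK _ y0) scalerA -cofrM [in RHS]mulrC.
  rewrite -scalerDl.
  rewrite (_ : _ + _ = 1) ?scale1r //.
  rewrite /cofr; apply/eqP; rewrite eq_complex /= addr0 eqxx andbT; apply/eqP.
  by field.
apply: le_trans (enormD _ _) _; rewrite mulr2n lerD //.
  rewrite enormZ enorm_sproj // mulr1 cabs_cofr normrM normfV (gtr0_norm zp).
  rewrite ler_pM2r ?invr_gt0 // ler_norml lerNl opprB enorm_sub_ge /=.
  by rewrite enorm_distC enorm_sub_ge.
by rewrite enormZ cabs_cofr_ge0 ?invr_ge0 ?enorm_ge0 // mulrC.
Qed.

Definition cont_sphere (h : 'rV[Cplx R]_N -> R) : Prop :=
  forall x, enorm x = 1 -> forall e : R, 0 < e -> exists2 r : R, 0 < r &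
    forall y, enorm y = 1 -> enorm (y - x) < r -> `|h y - h x| < e.

Definition ccont_sphere (h : 'rV[Cplx R]_N -> Cplx R) : Prop :=
  forall x, enorm x = 1 -> forall e : R, 0 < e -> exists2 r : R, 0 < r &
    forall y, enorm y = 1 -> enorm (y - x) < r -> cabs (h y - h x) < e.

(** Domain on which spherical integrals are computed: for a function of [z/|z|] the radial variable
    only contributes a constant factor. The origin is removed because [sproj] is discontinuous
    there. *)
Definition punctured_ball : set Om :=
  [set t | 0 < enorm (tuple_to_cvec t) < 1].

Lemma measurable_punctured_ball : measurable punctured_ball.
Proof.
apply: (@measurable_preimage_open [set z | 0 < enorm z < 1]).
rewrite openE => z /andP[z0 z1]; apply/nbhs_enorm.
exists (Num.min (enorm z) (1 - enorm z)); first by rewrite lt_min z0 subr_gt0.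
move=> y; rewrite lt_min => /andP[h1 h2] /=; apply/andP; split.
  have := enorm_sub_ge z y; rewrite enorm_distC; lra.
have := enorm_sub_ge y z; lra.
Qed.

Lemma measurable_sproj_gt (h : 'rV[Cplx R]_N -> R) (c : R) : cont_sphere h ->
  measurable (punctured_ball `&` [set t | c < h (sproj (tuple_to_cvec t))]).
Proof.
move=> hc.
rewrite (_ : _ `&` _ = punctured_ball `&`
    (@tuple_to_cvec R N @^-1` [set z | enorm z != 0 /\ c < h (sproj z)])); last first.
  apply/seteqP; split=> t /= [] /[dup] tB /andP[t0 t1] h1; split=> //.
    by split=> //; rewrite gt_eqF.
  by case: h1.
apply: measurableI; first exact: measurable_punctured_ball.
apply: measurable_preimage_open; rewrite openE => z [z0 hz]; apply/nbhs_enorm.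
have zp : 0 < enorm z by rewrite lt0r z0 enorm_ge0.
have hz' : 0 < h (sproj z) - c by rewrite subr_gt0.
have [r r0 rP] := hc _ (enorm_sproj _ z0) _ hz'.
(* The first bound keeps [y] away from [0]; the second gives [|sproj y - sproj z| < r] through
   [sproj_dist]. *)
exists (Num.min (enorm z) (r * enorm z / 2)).
  by rewrite lt_min zp /= divr_gt0 // mulr_gt0.
move=> y; rewrite lt_min => /andP[h1 h2] /=.
have yp : enorm y != 0.
  by rewrite gt_eqF //; have := enorm_sub_ge z y; rewrite enorm_distC; lra.
split=> //; have /(_ _)/ltr_normlP[] := rP (sproj y) (enorm_sproj _ yp); last by lra.
apply: le_lt_trans (sproj_dist _ _ z0 yp) _.
rewrite -mulr_natr mulrAC ltr_pdivrMr //; lra.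
Qed.

Lemma measurable_sproj_le (h : 'rV[Cplx R]_N -> R) (c : R) : cont_sphere h ->
  measurable (punctured_ball `&` [set t | h (sproj (tuple_to_cvec t)) <= c]).
Proof.
move=> hc; rewrite (_ : _ `&` _ = punctured_ball `\`
    (punctured_ball `&` [set t | c < h (sproj (tuple_to_cvec t))])).
  by apply: measurableD; [exact: measurable_punctured_ball|exact: measurable_sproj_gt].
apply/seteqP; split=> t /= [tB].
  by rewrite leNgt => /negP h1; split=> // -[].
by move=> h1; split=> //; rewrite leNgt; apply/negP => h2; apply: h1.
Qed.

Lemma measurable_fun_sproj (h : 'rV[Cplx R]_N -> R) : cont_sphere h ->
  measurable_fun punctured_ball (fun t => h (sproj (tuple_to_cvec t))).
Proof.
move=> hc mD; apply: (measurability _ (measurable_realfun.RGenOInfty.measurableE R)) => //.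
move=> /= _ [_ [x ->] <-].
have := measurable_sproj_gt _ x hc; congr (measurable (_ `&` _)).
by apply/seteqP; split=> t /=; rewrite in_itv /= andbT.
Qed.

End measurability.

Section polar.
Context {R : realType} {N : nat}.
Let Om := (N + N).-tuple (measurableTypeR R).

Lemma enorm_tuple_eq0 (t : Om) :
  enorm (tuple_to_cvec t) = 0 -> tuple_box (N + N) (0 : R) t.
Proof.
move=> /enorm0_eq0 t0 i; rewrite oppr0 -eq_le.
case: (split_ordP i) => k ->.
  by have /rowP/(_ k) := t0; rewrite !mxE => -[-> _].
by have /rowP/(_ k) := t0; rewrite !mxE => -[_ ->].
Qed.

Lemma enorm_tuple_box (t : Om) (r : R) :
  tuple_box (N + N) r t -> enorm (tuple_to_cvec t) <= r *+ (N + N).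
Proof.
move=> tr; pose o : Om := [tuple 0 | i < N + N].
have o0 : tuple_to_cvec o = 0 :> 'rV[Cplx R]_N by apply/rowP => k; rewrite !mxE !tnth_mktuple.
rewrite -[X in enorm X]subr0 -o0; apply: tuple_to_cvec_dist => i.
by rewrite tnth_mktuple subr0 ler_norml; exact: tr.
Qed.

Lemma tuple_box_enorm (t : Om) (r : R) :
  enorm (tuple_to_cvec t) <= r -> tuple_box (N + N) r t.
Proof.
move=> tr i; rewrite -ler_norml; apply: le_trans tr.
case: (split_ordP i) => k ->; apply: le_trans (cabs_coord_le _ k); rewrite mxE.
  exact: (cabs_cre (Complex _ _)).
exact: (cabs_cim (Complex _ _)).
Qed.

Lemma radial_cone_sphere (E : set 'rV[Cplx R]_N) : E `<=` unit_sphere R N ->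
  @tuple_to_cvec R N @^-1` radial_cone E =
  punctured_ball `&` [set t | E (sproj (tuple_to_cvec t))].
Proof.
move=> ES; apply/seteqP; split=> t /=.
  move=> [r [w [/andP[r0 r1] Ew tE]]].
  have w1 : enorm w = 1 by exact: ES.
  split; last by rewrite /= tE sproj_scale.
  by rewrite /punctured_ball /= tE enormZ w1 mulr1 cabs_cofr_ge0 ?ltW // r0 r1.
move=> [/andP[t0 t1] Et]; exists (enorm (tuple_to_cvec t)), (sproj (tuple_to_cvec t)).
by split; rewrite ?t0 ?t1 // sprojK // gt_eqF.
Qed.

(** The cone over [E] is the part of the punctured ball that projects into [E], and the origin is a
    null set because [0^(2N) = 0] for [N > 0]. Cubes inside and around the ball show that its volume
    is positive and finite. *)
Lemma sphere_measureE : (0 < N)%N ->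
  exists mu : {sigma_finite_measure set Om -> \bar R},
    [/\ (0 < mu punctured_ball)%E, (mu punctured_ball < +oo)%E &
      forall E, E `<=` unit_sphere R N ->
        sphere_measure E = (mu (punctured_ball `&` [set t | E (sproj (tuple_to_cvec t))])
          * ((fine (mu punctured_ball))^-1)%:E)%E].
Proof.
move=> N0; have [mu muE muB] := lebesgue_measure_tupleE R (N + N).
exists mu.
have mB : measurable (@punctured_ball R N) by exact: measurable_punctured_ball.
pose B : set Om := @tuple_to_cvec R N @^-1` unit_ball R N.
have B_eq : B = punctured_ball `|` tuple_box (N + N) 0.
  apply/seteqP; split=> t /=.
    move=> tB; have := enorm_ge0 (tuple_to_cvec t); rewrite le_eqVlt => /orP[/eqP/esym|] t0.
      by right; exact: enorm_tuple_eq0.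
    by left; apply/andP; split.
  case=> [/andP[]//|/enorm_tuple_box]; rewrite mul0rn /B /unit_ball /= => h.
  by apply: le_lt_trans h ltr01.
have NN : (N + N)%N != 0 by rewrite addn_eq0 negb_and -lt0n N0.
have mu0 : mu (tuple_box (N + N) 0) = 0%E.
  by rewrite muB // mul0rn expr0n (negbTE NN).
have muBE : mu B = mu punctured_ball.
  apply/eqP; rewrite eq_le; apply/andP; split.
    rewrite B_eq; apply: le_trans (measureU2 _ _ _) _ => //.
      exact: measurable_tuple_box.
    have mu0' : (mu (tuple_box (N + N) 0) <= 0)%E by rewrite mu0.
    by rewrite -[leRHS]adde0; apply: leeD => //; exact: mu0'.
  apply: le_measure; rewrite ?inE //.
    by rewrite B_eq; apply: measurableU => //; exact: measurable_tuple_box.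
  by rewrite B_eq; exact: subsetUl.
split.
- rewrite -muBE.
  pose r : R := (N + N).+1%:R^-1.
  have r0 : 0 < r by rewrite invr_gt0.
  apply: (@lt_le_trans _ _ (mu (tuple_box (N + N) r))).
    by rewrite muB ?ltW // lte_fin exprn_gt0 // pmulrn_lgt0.
  apply: le_measure; rewrite ?inE //; first exact: measurable_tuple_box.
    by rewrite B_eq; apply: measurableU => //; exact: measurable_tuple_box.
  move=> t /enorm_tuple_box tr; rewrite /B /unit_ball /=; apply: le_lt_trans tr _.
  by rewrite /r -[_ *+ (N + N)]mulr_natl ltr_pdivrMr // mul1r ltr_nat.
- apply: (@le_lt_trans _ _ (mu (tuple_box (N + N) 1))); last by rewrite muB // ltry.
  apply: le_measure; rewrite ?inE //; first exact: measurable_tuple_box.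
  by move=> t /andP[_ /ltW]; exact: tuple_box_enorm.
move=> E ES; rewrite /sphere_measure /volume -muE radial_cone_sphere //.
by rewrite -/B muBE.
Qed.

Let cbox : set 'rV[Cplx R]_N := [set v | forall i : 'I_N,
  [set x : Cplx R | `|cre x| <= 1 /\ `|cim x| <= 1] (v ord0 i)].

Lemma compact_square : compact [set x : Cplx R | `|cre x| <= 1 /\ `|cim x| <= 1].
Proof.
have := compact_setX (@segment_compact R (-1) 1) (@segment_compact R (-1) 1).
pose f (p : R * R) : Cplx R := Complex p.1 p.2.
move=> /(@continuous_compact _ _ f) H.
have -> : [set x : Cplx R | `|cre x| <= 1 /\ `|cim x| <= 1] =
    f @` (`[-1, 1]%classic `*` `[-1, 1]%classic).
  apply/seteqP; split=> [x /= [x1 x2]|x [p /= [p1 p2] <-]].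
    exists (cre x, cim x); last by case: x {x1 x2}.
    by rewrite /= !in_itv /= -!ler_norml.
  by rewrite !ler_norml /=; rewrite !in_itv in p1 p2.
apply: H; apply: continuous_subspaceT => p; apply/cvgrPdist_lt => /= e e0.
have er : e = cofr (cre e).
  by case: e e0 => a b; rewrite ltcE /= /cofr /cre /= => /andP[/eqP -> _].
have r0 : 0 < cre e / 2 by rewrite divr_gt0 // -ltc_cofr -er.
exists (ball p.1 (cre e / 2), ball p.2 (cre e / 2)).
  by split; exact: nbhsx_ballx.
move=> q [/= q1 q2].
rewrite normr_cabs er ltc_cofr; apply: le_lt_trans (cabs_le_reim _) _.
move: q1 q2; rewrite /ball /= => q1 q2.
rewrite /cre /cim /= in q1 q2 *; lra.
Qed.

Lemma closed_sphere : closed (unit_sphere R N).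
Proof.
rewrite -[X in closed X]setCK; apply: open_closedC; rewrite openE => z /= z1.
apply/nbhs_enorm; exists `|enorm z - 1|; first by rewrite normr_gt0 subr_eq0; exact/eqP.
move=> y /[swap]; rewrite /unit_sphere /= => y1.
apply/negP; rewrite -leNgt -y1 ler_norml lerNl opprB enorm_sub_ge /=.
by rewrite enorm_distC enorm_sub_ge.
Qed.

Lemma compact_sphere : compact (unit_sphere R N).
Proof.
apply: (subclosed_compact closed_sphere (B := cbox)).
  exact: (@rV_compact (Cplx R) N (fun _ => [set x : Cplx R | `|cre x| <= 1 /\ `|cim x| <= 1])
    (fun _ => compact_square)).
move=> z z1 i; split; apply: le_trans (cabs_cre _) _ || apply: le_trans (cabs_cim _) _;
  by rewrite -z1 cabs_coord_le.
Qed.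

End polar.

(** * Uniform continuity and boundedness on the sphere *)

Section sphere_continuity.
Context {R : realType} {N : nat}.
Implicit Types (w : 'rV[Cplx R]_N -> Cplx R) (z : 'rV[Cplx R]_N).

Lemma within_ccont_sphere w :
  {within unit_sphere R N, continuous w} -> ccont_sphere w.
Proof.
move=> /subspace_continuousP cw x x1 e e0.
have : nbhs (w x) [set y | cabs (y - w x) < e] by apply/nbhs_cabs; exists e.
by move=> /(cw x x1)/nbhs_enorm[r r0 rP]; exists r => // y y1 /rP; apply.
Qed.

(** Heine-Cantor in near-covering form: around each point the radius [1/(n+1)] works for all large
    [n], and compactness yields one [n] for the whole sphere. *)
Lemma ccont_sphere_unif w : ccont_sphere w -> forall e : R, 0 < e ->
  exists2 r : R, 0 < r & forall x y, enorm x = 1 -> enorm y = 1 ->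
    enorm (x - y) < r -> cabs (w x - w y) < e.
Proof.
move=> cw e e0; have e2 : 0 < e / 2 by rewrite divr_gt0.
have /compact_near_coveringP/near_covering_withinP := @compact_sphere R N.
pose P (n : nat) z := forall y, enorm y = 1 -> enorm (z - y) < n.+1%:R^-1 ->
  cabs (w z - w y) < e.
move=> /(_ nat \oo P _) [].
  move=> x x1; have [r r0 rP] := cw x x1 _ e2.
  have r2 : 0 < r / 2 by rewrite divr_gt0.
  exists ([set z | enorm (z - x) < r / 2], [set n | (n.+1%:R^-1 : R) < r / 2]).
    split; first by apply/nbhs_enorm; exists (r / 2).
    exact: near_infty_natSinv_lt (PosNum r2).
  move=> [z n] [/= zx nr] z1 y y1 zy; have {nr}zy := lt_trans zy nr.
  have h1 : cabs (w z - w x) < e / 2 by apply: rP => //; lra.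
  have h2 : cabs (w y - w x) < e / 2.
    apply: rP => //; rewrite -[y - x](subrKA z).
    by apply: le_lt_trans (enormD _ _) _; rewrite (enorm_distC y); lra.
  rewrite -[w z - w y](subrKA (w x)).
  by apply: le_lt_trans (cabsD _ _) _; rewrite (cabs_distC (w x)); lra.
move=> n _ /(_ n (leqnn n)) nP; exists n.+1%:R^-1; first by rewrite invr_gt0.
by move=> x y x1 y1 xy; apply: nP.
Qed.

Lemma ccont_sphere_bounded w : ccont_sphere w ->
  exists B : R, forall x, enorm x = 1 -> cabs (w x) <= B.
Proof.
move=> cw.
have /compact_near_coveringP/near_covering_withinP := @compact_sphere R N.
pose P (n : nat) z := cabs (w z) <= n%:R.
move=> /(_ nat \oo P _) [].
  move=> x x1; have [r r0 rP] := cw x x1 _ ltr01.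
  exists ([set z | enorm (z - x) < r], [set n | (Num.trunc (cabs (w x) + 1) < n)%N]).
    split; first by apply/nbhs_enorm; exists r.
    by exists (Num.trunc (cabs (w x) + 1)).+1.
  move=> [z n] [/= zx nr] z1; rewrite /P.
  have h1 : cabs (w z - w x) < 1 by apply: rP.
  apply: (@le_trans _ _ (cabs (w x) + 1)); first by have := cabs_sub_ge (w z) (w x); lra.
  apply/ltW; apply: lt_le_trans (truncnS_gt _) _.
  by rewrite ler_nat.
move=> n _ /(_ n (leqnn n)) nP; exists n%:R => x x1; exact: nP.
Qed.

Lemma closed_cabs_le w (c : R) : ccont_sphere w ->
  closed [set z | enorm z = 1 /\ cabs (w z) <= c].
Proof.
move=> cw; rewrite -[X in closed X]setCK; apply: open_closedC; rewrite openE => z /= zP.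
have [z1|z1] := eqVneq (enorm z) 1; last first.
  have : (~` unit_sphere R N) z by exact/eqP.
  have := open_closedC; have := @closed_sphere R N => /closed_openC.
  rewrite openE => H _ /H; apply: filterS => y /= yS [] y1 _; exact: yS.
have wz : 0 < cabs (w z) - c by rewrite subr_gt0 ltNge; apply/negP => h; apply: zP.
have [r r0 rP] := cw z z1 _ wz; apply/nbhs_enorm; exists r => // y yz [y1 wy].
have := rP y y1 yz; rewrite cabs_distC; have := cabs_sub_ge (w z) (w y); lra.
Qed.

Lemma closed_borel (A : set 'rV[Cplx R]_N) : closed A -> borel_set A.
Proof.
move=> cA; rewrite /borel_set -[A]setCK -setTD.
apply: (@sigma_algebraCD _ setT).
by apply: sub_sigma_algebra; exact: closed_openC.
Qed.

End sphere_continuity.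

(** * Radial derivatives and peak polynomials *)

Section radial.
Context {R : realType} {N : nat}.
Implicit Types (f g : 'rV[Cplx R]_N -> Cplx R) (z : 'rV[Cplx R]_N).

Lemma radial_derivative_diff f z : differentiable f z ->
  radial_derivative f z = 'd f z z.
Proof.
move=> df; transitivity ('d f z (\sum_j z 0 j *: 'e_j)); last by rewrite -row_sum_delta.
rewrite linear_sum /=.
by apply: eq_bigr => k _; rewrite deriveE; [rewrite linearZ_LR|exact: df].
Qed.

(** Keeps differentiability and the value of the radial derivative together, so that sums, products
    and powers compose. The rules come from those of the differential, applied to the vector [z]
    itself. *)
Definition rad_diff f Df z := differentiable f z /\ radial_derivative f z = Df.

Lemma rad_diff_cst (c : Cplx R) z : rad_diff (cst c) 0 z.
Proof.
have dc : differentiable (cst c) z by exact: differentiable_cst.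
by split=> //; rewrite radial_derivative_diff // diff_cst.
Qed.

Lemma rad_diffD f g a b z : rad_diff f a z -> rad_diff g b z ->
  rad_diff (fun z => f z + g z) (a + b) z.
Proof.
move=> [df fa] [dg gb].
have dfg : differentiable (f + g) z by exact: differentiableD.
split=> //; rewrite radial_derivative_diff // diffD // -fa -gb.
by rewrite !radial_derivative_diff.
Qed.

Lemma rad_diffM f g a b z : rad_diff f a z -> rad_diff g b z ->
  rad_diff (fun z => f z * g z) (f z * b + g z * a) z.
Proof.
move=> [df fa] [dg gb].
have dfg : differentiable (f * g) z by exact: differentiableM.
split=> //; rewrite radial_derivative_diff // diffM // -fa -gb.
by rewrite !radial_derivative_diff.
Qed.

Lemma rad_diff_coord k z : rad_diff (fun z => z ord0 k) (z ord0 k) z.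
Proof.
have @f : {linear 'rV[Cplx R]_N -> Cplx R}.
  by exists (fun z => z ord0 k); do 2![eexists]; do ?[constructor];
     rewrite ?mxE// => ? *; rewrite ?mxE//; move=> ?; rewrite !mxE.
have fc : continuous f by exact: coord_continuous.
have df : differentiable f z by exact/linear_differentiable.
by split=> //; rewrite radial_derivative_diff // (diff_lin _ fc).
Qed.

Lemma rad_diff_inner w z : rad_diff (inner ^~ w) (inner z w) z.
Proof.
rewrite /inner; elim: (index_enum _) => [|k s IH].
  rewrite big_nil; under [X in rad_diff X]eq_fun do rewrite big_nil.
  exact: rad_diff_cst.
rewrite big_cons; under [X in rad_diff X]eq_fun do rewrite big_cons.
apply: rad_diffD => //.
have := rad_diffM _ _ _ _ _ (rad_diff_coord k z) (rad_diff_cst (ccj (w ord0 k)) z).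
by rewrite mulr0 add0r mulrC.
Qed.

Lemma rad_diffX f a n z : rad_diff f a z ->
  rad_diff (fun z => f z ^+ n.+1) (n.+1%:R * f z ^+ n * a) z.
Proof.
move=> fa; elim: n => [|n IH].
  under [X in rad_diff X]eq_fun do rewrite expr1.
  by rewrite expr0 !mul1r.
under [X in rad_diff X]eq_fun do rewrite exprS.
have := rad_diffM _ _ _ _ _ fa IH; congr rad_diff.
by rewrite -[n.+2%:R]natr1 exprS; ring.
Qed.

Definition half : Cplx R := cofr 2^-1.

(** On the sphere a power of [u = <z, w>] alone has modulus [1] on the whole circle through [w]; the
    factor [(1 + u)/2] singles out [u = 1]. The factor [u] gives the decay [rho^(n+1)] inside the
    ball. *)
Definition peak (n : nat) (w z : 'rV[Cplx R]_N) : Cplx R :=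
  (inner z w * (half * (1 + inner z w))) ^+ n.+1.

Definition peak_rad (n : nat) (w z : 'rV[Cplx R]_N) : Cplx R :=
  n.+1%:R * (inner z w * (half * (1 + inner z w))) ^+ n *
  (half * (inner z w * (1 + inner z w *+ 2))).

Lemma rad_diff_peak n w z : rad_diff (peak n w) (peak_rad n w z) z.
Proof.
apply: rad_diffX; rewrite (_ : half * _ = inner z w * (half * (0 + inner z w) + (1 + inner z w) * 0)
   + half * (1 + inner z w) * inner z w); last by rewrite mulr2n; ring.
apply: (rad_diffM (inner ^~ w)); first exact: rad_diff_inner.
apply: (rad_diffM (cst half)); first exact: rad_diff_cst.
apply: (rad_diffD (cst 1)); [exact: rad_diff_cst|exact: rad_diff_inner].
Qed.

Lemma cabs_half : cabs half = 2^-1.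
Proof. by rewrite cabs_cofr_ge0. Qed.

Lemma cre_inner_dist z w : enorm z = 1 -> enorm w = 1 ->
  cre (inner z w) = 1 - enorm (z - w) ^+ 2 / 2.
Proof. by move=> z1 w1; rewrite enormB_sqr z1 w1 expr1n -mulr_natr; field. Qed.

(** Uniformity in [rho] is the point: the Bloch norm needs the peaks to be summable over the net on
    every concentric sphere, not only on the boundary. *)
Lemma cabs_half1_le (rho : R) z w : 0 <= rho <= 1 -> enorm z = 1 -> enorm w = 1 ->
  cabs (half * (1 + inner (cofr rho *: z) w)) <= expR (- enorm (z - w) ^+ 2 / 20).
Proof.
move=> /andP[r0 r1] z1 w1; set d := enorm (z - w).
have d0 : 0 <= d by exact: enorm_ge0.
have d2 : d <= 2 by have := enormB z w; rewrite z1 w1 -/d; lra.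
rewrite -(@ler_pXn2r _ 2) ?nnegrE ?cabs_ge0 ?expR_ge0 // -expRM_natl.
apply: (@le_trans _ _ (1 + - d ^+ 2 / 10)); last first.
  by apply: le_trans (expR_ge1Dx _) _; rewrite ler_expR; lra.
set v := inner z w; have cv : cabs v <= 1 by exact: cabs_inner_le1.
have rv : cre v = 1 - d ^+ 2 / 2 by exact: cre_inner_dist.
rewrite innerZl -/v cabsM cabs_half exprMn cabs_sqr.
rewrite cre_is_additive cim_is_additive cre_cofrM cim_cofrM cre1 cim1 add0r.
have : cre v ^+ 2 + cim v ^+ 2 <= 1 by rewrite -cabs_sqr expr_le1 // cabs_ge0.
move: (cre v) (cim v) rv => a b -> h.
have : rho ^+ 2 * ((1 - d ^+ 2 / 2) ^+ 2 + b ^+ 2) <= rho ^+ 2.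
  by rewrite ler_piMr ?sqr_ge0.
(* Four times the gap between [1 - d^2/10] and [((1 + rho)^2 - rho d^2)/4], which bounds the squared
   modulus. It is nonnegative because [d^2 <= 4]. *)
have : 0 <= (1 - rho) * (3 + rho) - d ^+ 2 * (2 / 5 - rho).
  have dd : d ^+ 2 <= 4 by nra.
  have dd0 : 0 <= d ^+ 2 by exact: sqr_ge0.
  by case: (leP rho (2/5)) => ?; nra.
nra.
Qed.

Lemma cabs_peak_le (rho : R) n z w : 0 <= rho <= 1 -> enorm z = 1 -> enorm w = 1 ->
  cabs (peak n w (cofr rho *: z)) <=
  rho ^+ n.+1 * expR (- enorm (z - w) ^+ 2 / 20) ^+ n.+1.
Proof.
move=> r01 z1 w1; have /andP[r0 r1] := r01.
rewrite /peak cabsX -exprMn lerXn2r ?nnegrE ?cabs_ge0 ?mulr_ge0 ?expR_ge0 //.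
rewrite cabsM; apply: ler_pM; rewrite ?cabs_ge0 // ?cabs_half1_le //.
rewrite innerZl cabsM cabs_cofr_ge0 // ler_piMr // cabs_inner_le1 //.
Qed.

(** Differentiation lowers the exponent of the Gaussian to [n], but the derivative [u (1 + 2u)/2] of
    the base still contains [u], which restores the full power [rho^(n+1)]. *)
Lemma cabs_peak_rad_le (rho : R) n z w : 0 <= rho <= 1 -> enorm z = 1 -> enorm w = 1 ->
  cabs (peak_rad n w (cofr rho *: z)) <=
  2 * (n.+1%:R * rho ^+ n.+1) * expR (- enorm (z - w) ^+ 2 / 20) ^+ n.
Proof.
move=> r01 z1 w1; have /andP[r0 r1] := r01.
have ur : cabs (inner (cofr rho *: z) w) <= rho.
  by rewrite innerZl cabsM cabs_cofr_ge0 // ler_piMr // cabs_inner_le1.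
rewrite /peak_rad; set u := inner _ _ in ur *.
have -> : (n.+1%:R : Cplx R) = cofr n.+1%:R.
  by elim: n.+1 => [|k IH] //; rewrite -!natr1 IH; apply/eqP; rewrite eq_complex /= addr0 !eqxx.
rewrite !cabsM cabs_cofr_ge0 // cabsX cabs_half.
have h1 : cabs (1 + u *+ 2) <= 3.
  rewrite mulr2n; apply: le_trans (cabsD _ _) _; rewrite cabs1.
  have := cabsD u u; lra.
have h2 : cabs (u * (half * (1 + u))) ^+ n <= rho ^+ n * expR (- enorm (z - w) ^+ 2 / 20) ^+ n.
  rewrite -exprMn lerXn2r ?nnegrE ?cabs_ge0 ?mulr_ge0 ?expR_ge0 //.
  by rewrite cabsM; apply: ler_pM; rewrite ?cabs_ge0 // ?cabs_half1_le.
rewrite [leRHS](_ : _ = n.+1%:R * (rho ^+ n * expR (- enorm (z - w) ^+ 2 / 20) ^+ n) *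
  (2^-1 * (rho * 4))); last by rewrite exprS; field.
apply: ler_pM; rewrite ?mulr_ge0 ?exprn_ge0 ?cabs_ge0 ?invr_ge0 //.
  by apply: ler_pM; rewrite ?exprn_ge0 ?cabs_ge0.
apply: ler_pM; rewrite ?mulr_ge0 ?cabs_ge0 ?invr_ge0 //.
apply: ler_pM; rewrite ?cabs_ge0 //; lra.
Qed.

Lemma bernoulli_onem (x : R) n : 0 <= x <= 1 -> 1 - x *+ n <= (1 - x) ^+ n.
Proof.
move=> /andP[x0 x1]; elim: n => [|n IH]; first by rewrite mulr0n subr0.
rewrite exprS; have : (1 - x) * (1 - x *+ n) <= (1 - x) * (1 - x) ^+ n.
  by rewrite ler_wpM2l // subr_ge0.
apply: le_trans; rewrite mulrS.
have : 0 <= x * (x *+ n) by rewrite mulr_ge0 // mulrn_wge0.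
nra.
Qed.

(** With [d = |z - w|], both [|u|^2] and [|(1 + u)/2|^2] are at least [1 - d^2]; Bernoulli's
    inequality then gives [1 - 2 d^2 (n+1) >= 1/2]. *)
Lemma cabs_peak_ge n z w : enorm z = 1 -> enorm w = 1 ->
  enorm (z - w) ^+ 2 <= (4 * n.+1%:R)^-1 -> 2^-1 <= cabs (peak n w z) ^+ 2.
Proof.
move=> z1 w1; set d2 := _ ^+ 2 => dn.
have d0 : 0 <= d2 by exact: sqr_ge0.
have n1 : 1 <= n.+1%:R :> R by rewrite ler1n.
have dn' : d2 * n.+1%:R <= 4^-1.
  by rewrite -ler_pdivlMr //; apply: le_trans dn _; rewrite invfM.
have d1 : d2 <= 4^-1 by nra.
have rv : cre (inner z w) = 1 - d2 / 2 by exact: cre_inner_dist.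
rewrite /peak cabsX -exprM mulnC exprM.
apply: (@le_trans _ _ ((1 - d2 *+ 2) ^+ n.+1)).
  apply: le_trans (bernoulli_onem _ _ _); last by apply/andP; split; lra.
  by rewrite -(mulr_natr (d2 *+ 2)); move: (n.+1%:R : R) dn' => m dm; lra.
rewrite lerXn2r ?nnegrE ?sqr_ge0 //; first by lra.
rewrite cabsM exprMn cabs_sqr cabsM exprMn cabs_half cabs_sqr.
rewrite !cre_is_additive !cim_is_additive rv cre1 cim1 add0r.
move: (cim _) => b; have b0 := sqr_ge0 b.
have h1 : 1 - d2 <= (1 - d2 / 2) ^+ 2 + b ^+ 2 by nra.
have h2 : 1 - d2 <= 2^-1 ^+ 2 * ((1 + (1 - d2 / 2)) ^+ 2 + b ^+ 2) by nra.
have : (1 - d2) * (1 - d2) <= ((1 - d2 / 2) ^+ 2 + b ^+ 2) *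
    (2^-1 ^+ 2 * ((1 + (1 - d2 / 2)) ^+ 2 + b ^+ 2)).
  by apply: ler_pM => //; lra.
nra.
Qed.

Lemma is_poly_cst (c : Cplx R) : is_poly (fun _ : 'rV[Cplx R]_N => c).
Proof. by exists (mpoly.mpolyC N c) => z; rewrite mpoly.mevalC. Qed.

Lemma is_poly_coord (k : 'I_N) : is_poly (fun z : 'rV[Cplx R]_N => z ord0 k).
Proof. by exists (mpoly.mpolyX _ (mpoly.mnm1 k)) => z; rewrite mpoly.mevalXU. Qed.

Lemma is_polyD f g : is_poly f -> is_poly g -> is_poly (fun z => f z + g z).
Proof. by move=> [p pE] [q qE]; eexists => z; rewrite pE qE; exact/esym/mpoly.mevalD. Qed.

Lemma is_polyM f g : is_poly f -> is_poly g -> is_poly (fun z => f z * g z).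
Proof. by move=> [p pE] [q qE]; eexists => z; rewrite pE qE; exact/esym/mpoly.mevalM. Qed.

Lemma is_poly_sum (I : Type) (s : seq I) (F : I -> 'rV[Cplx R]_N -> Cplx R) :
  (forall i, is_poly (F i)) -> is_poly (fun z => \sum_(i <- s) F i z).
Proof.
move=> FP; elim: s => [|a s IH].
  by under [X in is_poly X]eq_fun do rewrite big_nil; exact: is_poly_cst.
by under [X in is_poly X]eq_fun do rewrite big_cons; exact: is_polyD.
Qed.

Lemma is_polyX f n : is_poly f -> is_poly (fun z => f z ^+ n).
Proof.
move=> fP; elim: n => [|n IH].
  by under [X in is_poly X]eq_fun do rewrite expr0; exact: is_poly_cst.
by under [X in is_poly X]eq_fun do rewrite exprS; exact: is_polyM.
Qed.

Lemma is_poly_peak n w : is_poly (peak n w).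
Proof.
have iP : is_poly (inner ^~ w).
  apply: (is_poly_sum _ _ (fun k z => z ord0 k * ccj (w ord0 k))) => k.
  by apply: is_polyM; [exact: is_poly_coord|exact: is_poly_cst].
apply: is_polyX; apply: (is_polyM (inner ^~ w)) => //.
apply: (is_polyM (fun=> half)); first exact: is_poly_cst.
by apply: (is_polyD (fun=> 1)) => //; exact: is_poly_cst.
Qed.

Lemma ccont_sphereD f g : ccont_sphere f -> ccont_sphere g ->
  ccont_sphere (fun z => f z + g z).
Proof.
move=> fc gc x x1 e e0; have e2 : 0 < e / 2 by rewrite divr_gt0.
have [r r0 rP] := fc x x1 _ e2; have [s s0 sP] := gc x x1 _ e2.
exists (Num.min r s); first by rewrite lt_min r0.
move=> y y1; rewrite lt_min => /andP[yr ys].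
rewrite opprD addrACA; apply: le_lt_trans (cabsD _ _) _.
have := rP y y1 yr; have := sP y y1 ys; lra.
Qed.

Lemma ccont_sphereN f : ccont_sphere f -> ccont_sphere (fun z => - f z).
Proof.
move=> fc x x1 e e0; have [r r0 rP] := fc x x1 _ e0.
by exists r => // y y1 yr; rewrite -opprD cabsN; exact: rP.
Qed.

Lemma ccont_sphereB f g : ccont_sphere f -> ccont_sphere g ->
  ccont_sphere (fun z => f z - g z).
Proof. by move=> fc gc; apply: ccont_sphereD => //; exact: ccont_sphereN. Qed.

Lemma continuous_ccont_sphere f : continuous f -> ccont_sphere f.
Proof. by move=> fc; apply: within_ccont_sphere; exact: continuous_subspaceT. Qed.

Lemma is_poly_continuous f : is_poly f -> continuous f.
Proof.
move=> [p pE]; have -> : f = fun z => \sum_(m <- mpoly.msupp p)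
     mpoly.mcoeff m p * \prod_i z ord0 i ^+ mpoly.fun_of_multinom m i.
  by apply/funext => z; rewrite pE mpoly.mevalE.
elim: (mpoly.msupp p) => [|m s IH].
  rewrite (_ : (fun z => _) = cst 0); first exact: cst_continuous.
  by apply/funext => z; rewrite big_nil.
rewrite (_ : (fun z => _) = (fun z => mpoly.mcoeff m p *
    \prod_i z ord0 i ^+ mpoly.fun_of_multinom m i) \+ (fun z => \sum_(m <- s)
    mpoly.mcoeff m p * \prod_i z ord0 i ^+ mpoly.fun_of_multinom m i)); last first.
  by apply/funext => z; rewrite big_cons.
move=> z; apply: continuousD; last exact: IH.
apply: continuousM; first exact: cst_continuous.
elim: (index_enum _) => [|i t IHt].
  rewrite (_ : (fun z => _) = cst 1); first exact: cst_continuous.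
  by apply/funext => y; rewrite big_nil.
rewrite (_ : (fun z => _) = (fun z => z ord0 i ^+ mpoly.fun_of_multinom m i) \*
    (fun z => \prod_(i <- t) z ord0 i ^+ mpoly.fun_of_multinom m i)); last first.
  by apply/funext => y; rewrite big_cons.
apply: (@continuousM (Cplx R)); last exact: IHt.
elim: (mpoly.fun_of_multinom m i) => [|k IHk].
  exact: cst_continuous.
rewrite (_ : (fun z => _) = (fun z => z ord0 i) \* (fun z => z ord0 i ^+ k)); last first.
  by apply/funext => y; rewrite exprS.
apply: (@continuousM (Cplx R)); last exact: IHk.
exact: coord_continuous.
Qed.

Lemma is_poly_ccont_sphere f : is_poly f -> ccont_sphere f.
Proof. by move=> fP; exact/continuous_ccont_sphere/is_poly_continuous. Qed.

End radial.

(** * Nets on the sphere *)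

Lemma sum_expR_dist {R : realType} (k y : R) (n : nat) : 0 < k ->
  \sum_(j < n) expR (- k * `|y - j%:R|) <= 2 / (1 - expR (- k)).
Proof.
move=> k0; set q := expR (- k).
have q0 : 0 < q by exact: expR_gt0.
have q1 : q < 1 by rewrite -expR0 ltr_expR oppr_lt0.
(* [H] is bounded and increasing, and its unit increments dominate the summand,
   so the sum telescopes. *)
pose H (t : R) := if t < y then expR (- k * (y - t)) else 2 - expR (- k * (t - y)).
have E1 (t : R) : 0 <= t -> expR (- k * t) <= 1.
  by move=> t0; rewrite -expR0 ler_expR mulNr oppr_le0 mulr_ge0 // ltW.
have H2 t : 0 <= H t <= 2.
  rewrite /H; case: ltP => ty.
    rewrite expR_ge0 /=; apply: le_trans (E1 _ _) _ => //; lra.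
  have := E1 (t - y); have := expR_gt0 (- k * (t - y)); rewrite subr_ge0 => ? /(_ ty) ?.
  by apply/andP; split; lra.
have step (t : R) : (1 - q) * expR (- k * `|y - t|) <= H (t + 1) - H t.
  rewrite /H; case: (ltP t y) => ty; last first.
    rewrite ifF; last by apply/negbTE; rewrite -leNgt; lra.
    rewrite ler0_norm ?subr_le0 // opprB.
    have -> : expR (- k * (t + 1 - y)) = q * expR (- k * (t - y)).
      by rewrite -expRD; congr expR; ring.
    by lra.
  rewrite gtr0_norm ?subr_gt0 //.
  have e0 : 0 <= expR (- k * (y - t)) by exact: expR_ge0.
  case: (ltP (t + 1) y) => ty1.
    have -> : expR (- k * (y - t)) = q * expR (- k * (y - (t + 1))).
      by rewrite -expRD; congr expR; ring.
    move: (expR_ge0 (- k * (y - (t + 1)))); set e := expR (- k * (y - (t + 1))) => e0'.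
    rewrite -[X in _ <= X - _]mul1r -mulrBl ler_pM2l ?subr_gt0 // ler_piMl // ltW //.
  have ab : expR (- k * (t + 1 - y)) * expR (- k * (y - t)) = q.
    by rewrite -expRD; congr expR; ring.
  have a1 : expR (- k * (t + 1 - y)) <= 1 by apply: E1; lra.
  have b1 : expR (- k * (y - t)) <= 1 by apply: E1; lra.
  move: ab a1 b1 e0; move: (expR (- k * (t + 1 - y))) (expR (- k * (y - t))) => a b.
  move=> ab a1 b1 b0; have : 0 <= (1 - a) * (1 - b) by rewrite mulr_ge0 ?subr_ge0.
  have : 0 <= (1 - q) * (1 - b) by rewrite mulr_ge0 ?subr_ge0 // ltW.
  have -> : (1 - a) * (1 - b) = 1 - a - b + q by rewrite -ab; ring.
  by lra.
rewrite ler_pdivlMr ?subr_gt0 // mulrC mulr_sumr.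
apply: (@le_trans _ _ (\sum_(j < n) (H j.+1%:R - H j%:R))).
  by apply: ler_sum => j _; rewrite -natr1; exact: step.
rewrite -(big_mkord xpredT (fun j => H j.+1%:R - H j%:R)) telescope_sumr //.
have /andP[_ h1] := H2 n%:R; have /andP[h2 _] := H2 0%:R; lra.
Qed.

Section net.
Context {R : realType} {N : nat}.
Implicit Types z w : 'rV[Cplx R]_N.

Definition rcoord z (i : 'I_(N + N)) : R :=
  match fintype.split i with inl k => cre (z ord0 k) | inr k => cim (z ord0 k) end.

Lemma enorm_sqr_rcoord z : enorm z ^+ 2 = \sum_i rcoord z i ^+ 2.
Proof.
rewrite enorm_sqr big_split_ord /= -big_split /=; apply: eq_bigr => k _.
rewrite cabs_sqr /rcoord; congr (_ ^+ 2 + _ ^+ 2).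
  by have := unsplitK (inl k : 'I_N + 'I_N); rewrite /unsplit => ->.
by have := unsplitK (inr k : 'I_N + 'I_N); rewrite /unsplit => ->.
Qed.

Lemma rcoordB z w i : rcoord (z - w) i = rcoord z i - rcoord w i.
Proof.
by rewrite /rcoord; case: (fintype.split i) => k; rewrite !mxE ?cre_is_additive ?cim_is_additive ?creN ?cimN.
Qed.

Lemma normr_rcoord_le z i : `|rcoord z i| <= enorm z.
Proof.
by rewrite /rcoord; case: (fintype.split i) => k; apply: le_trans (cabs_coord_le _ k);
  [exact: cabs_cre|exact: cabs_cim].
Qed.

(** One point of the sphere is chosen in each cell of side [1/m] that meets it. The Gaussian is a
    product over the [2N] real coordinates, so its sum over all cells factors into one-dimensional
    sums, bounded independently of [m] and [z]. *)
Lemma sphere_net (k : R) : 0 < k -> exists2 B : R, 0 < B & forall m : nat, (0 < m)%N ->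
  exists Z : seq 'rV[Cplx R]_N,
    [/\ forall w, w \in Z -> enorm w = 1,
        forall z, enorm z = 1 -> exists2 w, w \in Z &
          enorm (z - w) ^+ 2 <= (N + N)%:R / m%:R ^+ 2 &
        forall z, enorm z = 1 ->
          \sum_(w <- Z) expR (- k * m%:R ^+ 2 * enorm (z - w) ^+ 2) <= B].
Proof.
move=> k0; set B1 : R := expR (2 * k) * (2 / (1 - expR (- k))).
have B10 : 0 < B1.
  by rewrite mulr_gt0 ?expR_gt0 // divr_gt0 // subr_gt0 -expR0 ltr_expR oppr_lt0.
exists (B1 ^+ (N + N)); first exact: exprn_gt0.
move=> m m0; have mp : 0 < m%:R :> R by rewrite ltr0n.
pose cell (c : {ffun 'I_(N + N) -> 'I_(m + m).+1}) : set 'rV[Cplx R]_N :=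
  [set z | enorm z = 1 /\ forall i, (c i)%:R <= m%:R * (rcoord z i + 1) <= (c i)%:R + 1].
(* The default [0] only occurs for cells that miss the sphere, and [ne] filters those out. *)
pose pt c : 'rV[Cplx R]_N := xget 0 (cell c).
pose ne c : bool := `[< cell c !=set0 >].
have ptP c : ne c -> cell c (pt c).
  by move=> /asboolP[z cz]; exact: (xgetPex 0 (ex_intro _ z cz)).
exists [seq pt c | c <- enum {: {ffun 'I_(N + N) -> 'I_(m + m).+1}} & ne c].
split.
- by move=> w /mapP[c]; rewrite mem_filter => /andP[/ptP[w1 _] _] ->.
- move=> z z1.
  have zi i : 0 <= m%:R * (rcoord z i + 1) <= (m + m)%:R.
    have := normr_rcoord_le z i; rewrite z1 ler_norml natrD => /andP[h1 h2].
    by apply/andP; split; nra.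
  (* The index [2m] does occur, when a coordinate equals [1]; hence [(m + m).+1] cells per
     coordinate. *)
  have tr i : (Num.trunc (m%:R * (rcoord z i + 1)) < (m + m).+1)%N.
    rewrite ltnS -(ler_nat R); have /andP[h1 h2] := zi i.
    by apply: le_trans h2; rewrite truncn_le.
  pose c : {ffun 'I_(N + N) -> 'I_(m + m).+1} := [ffun i => Ordinal (tr i)].
  have zc : cell c z.
    split=> // i; rewrite ffunE /=; have /andP[h1 h2] := zi i.
    by rewrite truncn_le // h1 natr1 ltW // truncnS_gt.
  have nc : ne c by apply/asboolP; exists z.
  exists (pt c); first by apply: map_f; rewrite mem_filter nc mem_enum.
  have [_ pc] := ptP _ nc; have [_ {}zc] := zc.
  rewrite ler_pdivlMr ?exprn_gt0 // enorm_sqr_rcoord mulr_suml.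
  apply: (@le_trans _ _ (\sum_(i < N + N) 1)); last by rewrite sumr_const card_ord.
  apply: ler_sum => i _; rewrite rcoordB -exprMn.
  have := zc i; have := pc i; move: (c i) (rcoord z i) (rcoord (pt c) i) => e x y.
  by move=> /andP[h1 h2] /andP[h3 h4]; nra.
move=> z z1.
rewrite big_map big_filter big_enum_cond /=.
apply: (@le_trans _ _ (\sum_(c : {ffun 'I_(N + N) -> 'I_(m + m).+1})
   \prod_i (expR (2 * k) * expR (- k * `|m%:R * (rcoord z i + 1) - (c i)%:R|)))).
  rewrite [leRHS](bigID ne) /= -[leLHS]addr0 lerD //; last first.
    by apply: sumr_ge0 => c _; apply: prodr_ge0 => i _; rewrite mulr_ge0 ?expR_ge0.
  apply: ler_sum => c /ptP[_ pc].
  rewrite enorm_sqr_rcoord mulr_sumr expR_sum; apply: ler_prod => i _.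
  rewrite expR_ge0 -expRD ler_expR /= rcoordB.
  have := pc i; move: (rcoord z i) (rcoord (pt c) i) => x xi /andP[h1 h2].
  rewrite -subr_ge0; set y := m%:R * (x + 1).
  have -> : 2 * k + - k * `|y - (c i)%:R| - - k * m%:R ^+ 2 * (x - xi) ^+ 2 =
     k * (2 - `|y - (c i)%:R| + (y - m%:R * (xi + 1)) ^+ 2) by rewrite /y; ring.
  rewrite mulr_ge0 ?(ltW k0) //.
  move: h1 h2; move: (m%:R * (xi + 1)) => eta h1 h2.
  (* Trades the Gaussian for an exponential: [|y - eta| <= (y - eta)^2 + 1/4], and [eta] lies within
     [1] of the corner [c i], so the constant [2] is enough. *)
  have := sqr_ge0 (y - eta - 2^-1); have := sqr_ge0 (y - eta + 2^-1).
  by case: (ger0P (y - (c i)%:R)) => h3; nra.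
rewrite -(bigA_distr_bigA (fun i (j : 'I_(m + m).+1) => expR (2 * k) *
  expR (- k * `|m%:R * (rcoord z i + 1) - j%:R|))) /=.
rewrite -[X in _ ^+ X]card_ord -prodr_const; apply: ler_prod => i _.
rewrite sumr_ge0 /=; last by move=> j _; rewrite mulr_ge0 ?expR_ge0.
by rewrite -mulr_sumr ler_wpM2l ?expR_ge0 // sum_expR_dist.
Qed.

End net.

(** * The potential *)

Section potential.
Context {R : realType}.
Implicit Types (s r e x y : R) (w q : Cplx R).

(* [lphi |w|^2 = 2 ln |w|^2 - ln (1 + |w|^2)]: the first term is harmonic and the
   second one strictly subharmonic.  The difference still tends to infinity. *)
Definition lphi s : R := ln (s ^+ 2 / (1 + s)).

Lemma lphi_arg_gt0 s : 0 < s -> 0 < s ^+ 2 / (1 + s).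
Proof. by move=> s0; rewrite divr_gt0 ?exprn_gt0 // addr_gt0. Qed.

Lemma ln_le_subr1 x : 0 < x -> ln x <= x - 1.
Proof. by move=> x0; rewrite -{1}(subrKC 1 x); apply: le_ln1Dx; lra. Qed.

Lemma lphi_le s r : 0 < s -> s <= r -> lphi s <= lphi r.
Proof.
move=> s0 sr; have r0 : 0 < r by exact: lt_le_trans sr.
rewrite ler_ln ?posrE ?lphi_arg_gt0 // ler_pdivrMr ?addr_gt0 //.
rewrite mulrAC ler_pdivlMr ?addr_gt0 // -subr_ge0.
have -> : r ^+ 2 * (1 + s) - s ^+ 2 * (1 + r) = (r - s) * (r + s + r * s) by ring.
by rewrite mulr_ge0 ?subr_ge0 // !addr_ge0 ?mulr_ge0 // ltW.
Qed.

Lemma lphi_lip e s r : 0 < e -> e <= s -> s <= r -> lphi r - lphi s <= 2 * (r - s) / e.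
Proof.
move=> e0 es sr; have s0 : 0 < s by exact: lt_le_trans es.
have r0 : 0 < r by exact: lt_le_trans sr.
rewrite -ln_div ?posrE ?lphi_arg_gt0 //.
apply: (@le_trans _ _ (ln ((r / s) ^+ 2))).
  rewrite ler_ln ?posrE ?divr_gt0 ?exprn_gt0 ?divr_gt0 ?addr_gt0 //.
  rewrite exprMn exprVn invf_div.
  have -> : r ^+ 2 / (1 + r) * ((1 + s) / s ^+ 2) = r ^+ 2 / s ^+ 2 * ((1 + s) / (1 + r)).
    by rewrite mulf_div [RHS]mulf_div [s ^+ 2 * _]mulrC.
  rewrite ler_piMr ?divr_ge0 ?sqr_ge0 // ler_pdivrMr ?addr_gt0 //; lra.
rewrite lnXn ?divr_gt0 // -[ln _ *+ _]mulr_natl -mulrA ler_pM2l //.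
apply: le_trans (ln_le_subr1 _ (divr_gt0 r0 s0)) _.
have sn : s != 0 by rewrite gt_eqF.
rewrite -[X in _ - X](divff sn) -mulrBl.
by rewrite ler_wpM2l ?subr_ge0 // lef_pV2.
Qed.

(* With [s = |w|^2], [r = |q|^2], the four arguments on the left are
   [|w + i^j q|^2]: this is strict superharmonicity for four-point means. *)
Lemma lphi_sum4 s r x y : 0 < s -> 0 <= r -> 8 * r * (1 + s) ^+ 2 <= s ^+ 2 ->
  x ^+ 2 + y ^+ 2 = s * r ->
  0 < s + r + 2 * x -> 0 < s + r - 2 * x -> 0 < s + r + 2 * y -> 0 < s + r - 2 * y ->
  lphi (s + r + 2 * x) + lphi (s + r - 2 * x) + lphi (s + r + 2 * y) + lphi (s + r - 2 * y)
   <= 4 * lphi s - r / (1 + s) ^+ 2.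
Proof.
move=> s0 r0 rs xy a1 a2 a3 a4.
(* Since [x^2 + y^2 = s r], the product [P] exceeds [s^4] only to second order in
   [r], whereas [Q] exceeds [(1 + s)^4] to first order. *)
set P := (s + r + 2 * x) * (s + r - 2 * x) * (s + r + 2 * y) * (s + r - 2 * y).
set Q := (1 + (s + r + 2 * x)) * (1 + (s + r - 2 * x)) *
         (1 + (s + r + 2 * y)) * (1 + (s + r - 2 * y)).
have P0 : 0 < P by rewrite !mulr_gt0.
have Q0 : 0 < Q by rewrite !mulr_gt0 // addr_gt0.
have s1 : 0 < 1 + s by rewrite addr_gt0.
have lphiE t : 0 < t -> lphi t = 2 * ln t - ln (1 + t).
  by move=> t0; rewrite /lphi ln_div ?posrE ?exprn_gt0 ?addr_gt0 // lnXn // mulr_natl.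
have PE : ln P = ln (s + r + 2 * x) + ln (s + r - 2 * x) + ln (s + r + 2 * y) + ln (s + r - 2 * y).
  by rewrite /P !lnM ?posrE ?mulr_gt0 //.
have QE : ln Q = ln (1 + (s + r + 2 * x)) + ln (1 + (s + r - 2 * x)) +
    ln (1 + (s + r + 2 * y)) + ln (1 + (s + r - 2 * y)).
  by rewrite /Q !lnM ?posrE ?mulr_gt0 ?(addr_gt0 ltr01) //.
(* The tangent bound [ln x <= x - 1] reduces both logarithmic differences to rational
   inequalities. *)
have h1 : ln P - 4 * ln s <= P / s ^+ 4 - 1.
  have -> : 4 * ln s = ln (s ^+ 4) by rewrite lnXn // mulr_natl.
  by rewrite -ln_div ?posrE ?exprn_gt0 // ln_le_subr1 // divr_gt0 // exprn_gt0.
have h2 : 4 * ln (1 + s) - ln Q <= (1 + s) ^+ 4 / Q - 1.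
  have -> : 4 * ln (1 + s) = ln ((1 + s) ^+ 4) by rewrite lnXn // mulr_natl.
  by rewrite -ln_div ?posrE ?exprn_gt0 // ln_le_subr1 // divr_gt0 // exprn_gt0.
rewrite !lphiE //.
set t := r / (1 + s) ^+ 2.
have t0 : 0 <= t by rewrite divr_ge0 // sqr_ge0.
set v := r / s.
have v0 : 0 <= v by rewrite divr_ge0 // ltW.
have rt : r = t * (1 + s) ^+ 2 by rewrite /t divfK // expf_neq0 // gt_eqF.
have rv : r = v * s by rewrite /v divfK // gt_eqF.
(* The smallness hypothesis on [r], restated: the second-order excess of [P] is dominated by the
   first-order excess of [Q]. *)
have v2t : 8 * v ^+ 2 <= t.
  rewrite /t ler_pdivlMr ?exprn_gt0 //.
  have : v * (8 * r * (1 + s) ^+ 2) <= v * s ^+ 2 by rewrite ler_wpM2l.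
  have -> : v * (8 * r * (1 + s) ^+ 2) = s * (8 * v ^+ 2 * (1 + s) ^+ 2) by rewrite rv; ring.
  have -> : v * s ^+ 2 = s * r by rewrite rv; ring.
  by rewrite ler_pM2l.
have r8 : 8 * r <= 1.
  have : 8 * r * (1 + s) ^+ 2 <= (1 + s) ^+ 2 by apply: le_trans rs _; nra.
  by rewrite -[leRHS]mul1r ler_pM2r // exprn_gt0.
have t8 : 8 * t <= 1.
  rewrite /t mulrA ler_pdivrMr ?exprn_gt0 // mul1r; apply: le_trans r8 _; nra.
have P1 : P <= (s ^+ 2 + r ^+ 2) ^+ 2.
  have -> : P = (s + r) ^+ 4 - 4 * (s + r) ^+ 2 * (x ^+ 2 + y ^+ 2) + 16 * (x ^+ 2 * y ^+ 2).
    by rewrite /P; ring.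
  have : 4 * (x ^+ 2 * y ^+ 2) <= (x ^+ 2 + y ^+ 2) ^+ 2.
    by have := sqr_ge0 (x ^+ 2 - y ^+ 2); nra.
  rewrite xy; have -> : (s ^+ 2 + r ^+ 2) ^+ 2 = (s + r) ^+ 4 - 4 * (s + r) ^+ 2 * (s * r) + 4 * (s * r) ^+ 2 by ring.
  lra.
have Q1 : (1 + s) ^+ 4 * (1 + 3 * t) <= Q.
  have -> : Q = (1 + s + r) ^+ 4 - 4 * (1 + s + r) ^+ 2 * (x ^+ 2 + y ^+ 2) + 16 * (x ^+ 2 * y ^+ 2).
    by rewrite /Q; ring.
  have : 0 <= x ^+ 2 * y ^+ 2 by rewrite mulr_ge0 ?sqr_ge0.
  have -> : (1 + s) ^+ 4 * (1 + 3 * t) = (1 + s) ^+ 4 + 3 * r * (1 + s) ^+ 2.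
    by rewrite [in RHS]rt; ring.
  rewrite xy.
  have -> : (1 + s + r) ^+ 4 - 4 * (1 + s + r) ^+ 2 * (s * r) =
    ((1 + s) ^+ 2 + r ^+ 2 + 2 * r) ^+ 2 - 4 * r ^+ 2 * s ^+ 2 by ring.
  have h : 0 <= r * (1 + s) ^+ 2 - 2 * r ^+ 2 * s ^+ 2 + 2 * r ^+ 2.
    have -> : r * (1 + s) ^+ 2 - 2 * r ^+ 2 * s ^+ 2 + 2 * r ^+ 2 =
      r * ((1 + s) ^+ 2 - 2 * (r * s ^+ 2) + 2 * r) by ring.
    apply: mulr_ge0 => //.
    have : r * s ^+ 2 <= s ^+ 2 by rewrite ler_piMl ?sqr_ge0 //; lra.
    have : 8 * (r * s ^+ 2) <= s ^+ 2 by rewrite mulrA ler_piMl ?sqr_ge0.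
    nra.
  have : 0 <= r ^+ 2 * (1 + s) ^+ 2 by rewrite mulr_ge0 ?sqr_ge0.
  have : 0 <= r ^+ 3 by rewrite exprn_ge0.
  have : 0 <= r ^+ 4 by rewrite exprn_ge0.
  move=> *; nra.
have P2 : P / s ^+ 4 <= (1 + v ^+ 2) ^+ 2.
  rewrite ler_pdivrMr ?exprn_gt0 //; apply: le_trans P1 _.
  by rewrite rv le_eqVlt; apply/orP; left; apply/eqP; ring.
have Q2 : (1 + s) ^+ 4 / Q <= 1 - 15 / 8 * t.
  rewrite ler_pdivrMr //.
  have : (1 - 15 / 8 * t) * ((1 + s) ^+ 4 * (1 + 3 * t)) <= (1 - 15 / 8 * t) * Q.
    by rewrite ler_wpM2l //; lra.
  apply: le_trans; rewrite mulrCA ler_peMr ?exprn_ge0 ?(ltW s1) //.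
  have : 0 <= t * (1 - 8 * t) by rewrite mulr_ge0 // subr_ge0.
  nra.
have : v ^+ 2 <= 1 / 64 by lra.
have : 0 <= v ^+ 2 by exact: sqr_ge0.
move: (v ^+ 2) v2t P2 => v2 v2t P2 v20 v264.
(* Balance: [ln P] counts twice and contributes at most [5 v^2 <= (5/8) t], while [Q] contributes at
   most [-(15/8) t]; the total is at most [-t]. *)
have : (1 + v2) ^+ 2 <= 1 + 5 / 2 * v2 by nra.
lra.
Qed.

(* The truncation at [e] makes [pot] bounded below; superharmonicity is only used
   where [|w|^2 >= e]. *)
Definition pot e w : R := lphi (Num.max (cabs w ^+ 2) e) - lphi e.

Lemma pot_ge0 e w : 0 < e -> 0 <= pot e w.
Proof. by move=> e0; rewrite subr_ge0 lphi_le // le_max lexx orbT. Qed.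

Lemma pot_le e w q : 0 < e -> cabs w <= cabs q -> pot e w <= pot e q.
Proof.
move=> e0 wq; rewrite lerD2r lphi_le ?lt_max ?e0 ?orbT //.
by rewrite ge_max !le_max lexx orbT andbT lerXn2r ?nnegrE ?cabs_ge0.
Qed.

Lemma pot_lip e w q : 0 < e -> pot e q - pot e w <=
  2 * (cabs (q - w) * (cabs (q - w) + cabs w *+ 2)) / e.
Proof.
move=> e0; have rhs0 : 0 <= 2 * (cabs (q - w) * (cabs (q - w) + cabs w *+ 2)) / e.
  by apply: divr_ge0; rewrite ?(ltW e0) // !mulr_ge0 ?addr_ge0 ?mulrn_wge0 ?cabs_ge0.
have [qw|qw] := leP (cabs q) (cabs w).
  by apply: le_trans rhs0; rewrite subr_le0 pot_le.
rewrite /pot opprB addrA subrK.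
have ew : e <= Num.max (cabs w ^+ 2) e by rewrite le_max lexx orbT.
have wq2 : cabs w ^+ 2 <= cabs q ^+ 2 by rewrite lerXn2r ?nnegrE ?cabs_ge0 // ltW.
apply: le_trans (lphi_lip _ _ _ e0 ew _) _.
  by rewrite ge_max !le_max wq2 lexx orbT.
rewrite -!mulrA ler_pM2l // mulrA ler_pM2r ?invr_gt0 //.
apply: (@le_trans _ _ (cabs q ^+ 2 - cabs w ^+ 2)).
  rewrite /Num.max; case: ifP => h1; case: ifP => h2; lra || (move/negbT: h1; move/negbT: h2; rewrite -?leNgt; lra).
have := cabs_sub_ge q w; have := cabs_ge0 w; have := cabs_ge0 q; rewrite mulr2n; nra.
Qed.

Definition ii : Cplx R := Complex 0 1.

Lemma pot_sum4 e w q : 0 < e -> e <= cabs w ^+ 2 ->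
  8 * cabs q ^+ 2 * (1 + e) ^+ 2 <= e ^+ 2 ->
  (forall j : 'I_4, e <= cabs (w + ii ^+ j * q) ^+ 2) ->
  \sum_(j < 4) pot e (w + ii ^+ j * q) <=
  4 * pot e w - cabs q ^+ 2 / (1 + cabs w ^+ 2) ^+ 2.
Proof.
move=> e0 ew qe jw.
have potE z : e <= cabs z ^+ 2 -> pot e z = lphi (cabs z ^+ 2) - lphi e.
  by move=> ez; rewrite /pot max_l.
set s := cabs w ^+ 2 in ew *; set r := cabs q ^+ 2 in qe *.
(* Real and imaginary parts of [w] times the conjugate of [q]; hence [x^2 + y^2 = s r]. *)
pose x := cre w * cre q + cim w * cim q; pose y := cim w * cre q - cre w * cim q.
have E0 : cabs (w + ii ^+ 0 * q) ^+ 2 = s + r + 2 * x.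
  by rewrite expr0 mul1r /s /r /x !cabs_sqr cre_is_additive cim_is_additive; ring.
have E1 : cabs (w + ii ^+ 1 * q) ^+ 2 = s + r + 2 * y.
  rewrite expr1 /s /r /y !cabs_sqr cre_is_additive cim_is_additive creM cimM /=.
  by rewrite !mul0r !mul1r; ring.
have i2 : ii ^+ 2 = -1.
  by apply/eqP; rewrite eq_complex /= !mulr0 !mul0r mulr1 sub0r addr0 oppr0 !eqxx.
have E2 : cabs (w + ii ^+ 2 * q) ^+ 2 = s + r - 2 * x.
  rewrite i2 mulN1r /s /r /x !cabs_sqr cre_is_additive cim_is_additive creN cimN; ring.
have E3 : cabs (w + ii ^+ 3 * q) ^+ 2 = s + r - 2 * y.
  rewrite [ii ^+ 3]exprS i2 mulrN1 mulNr /s /r /y !cabs_sqr cre_is_additive cim_is_additive creN cimN creM cimM /=.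
  by rewrite !mul0r !mul1r; ring.
have := jw (inord 0); have := jw (inord 1); have := jw (inord 2); have := jw (inord 3).
rewrite !inordK // E0 E1 E2 E3 => e3 e2 e1 e00.
rewrite !big_ord_recr big_ord0 /= add0r !potE ?E0 ?E1 ?E2 ?E3 //.
have s0 : 0 < s by exact: lt_le_trans ew.
have xy : x ^+ 2 + y ^+ 2 = s * r by rewrite /x /y /s /r !cabs_sqr; ring.
have := lphi_sum4 s r x y s0 (sqr_ge0 _) _ xy.
move=> H; have := H _ (lt_le_trans e0 e00) (lt_le_trans e0 e2) (lt_le_trans e0 e1) (lt_le_trans e0 e3).
move=> {}H; have {}H := H _; rewrite -[_ / _ ^+ 2]/(r / (1 + s) ^+ 2).
(* The condition passes from [e] to [s >= e] because [s/(1 + s)] is increasing. *)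
have : 8 * r * (1 + s) ^+ 2 <= s ^+ 2.
  have r0 : 0 <= r by exact: sqr_ge0.
  have h1 : 8 * r * (1 + e) ^+ 2 * s ^+ 2 <= e ^+ 2 * s ^+ 2 by rewrite ler_wpM2r ?sqr_ge0.
  have h2 : e * (1 + s) <= s * (1 + e) by nra.
  have h3 : (e * (1 + s)) ^+ 2 <= (s * (1 + e)) ^+ 2.
    by rewrite ler_pXn2r ?nnegrE //; apply: mulr_ge0; lra.
  have h4 : 8 * r * (e * (1 + s)) ^+ 2 <= 8 * r * (s * (1 + e)) ^+ 2.
    by rewrite ler_wpM2l // mulr_ge0.
  rewrite -(@ler_pM2l _ (e ^+ 2)) ?exprn_gt0 //.
  have -> : e ^+ 2 * (8 * r * (1 + s) ^+ 2) = 8 * r * (e * (1 + s)) ^+ 2 by ring.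
  apply: le_trans h4 _; rewrite exprMn; lra.
move=> /H; lra.
Qed.

Lemma pot_unbounded e (K : R) : 0 < e ->
  exists2 M : R, 0 < M & forall w, M <= cabs w -> K <= pot e w.
Proof.
(* For [s >= 1] one has [s^2/(1 + s) >= s/2]. The summand [1] ensures [|w| >= 1], hence
   [|w|^2 >= |w|]. *)
move=> e0; exists (2 * expR (K + lphi e) + 1) => [|w wM].
  by have := expR_gt0 (K + lphi e); lra.
have E := expR_gt0 (K + lphi e).
have w1 : 1 <= cabs w by lra.
have w2 : cabs w <= cabs w ^+ 2 by rewrite expr2 ler_peMr // cabs_ge0.
rewrite lerBrDr -[leLHS]expRK.
set s := Num.max _ _; have ws : cabs w ^+ 2 <= s by rewrite le_max lexx.
have s1 : 1 <= s by lra.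
rewrite ler_ln ?posrE ?expR_gt0 ?lphi_arg_gt0 //; last by lra.
rewrite ler_pdivlMr; last by lra.
have : expR (K + lphi e) * 2 <= s by lra.
move: (expR _) E => E E0 Es; nra.
Qed.

End potential.

(** * Averages of the potential over phases *)

Section averaged_potential.
Context {R : realType}.
Implicit Types (w q : Cplx R) (qs : seq (Cplx R)).

(** The mean over all phase choices, nested so that the four-point inequality and the selection of
    phases can treat one peak at a time. *)
Fixpoint avg_pot (e : R) w qs : R :=
  if qs is q :: qs' then (\sum_(j < 4) avg_pot e (w + ii ^+ j * q) qs') / 4
  else pot e w.

Lemma cabs_ii : cabs (ii : Cplx R) = 1.
Proof. by rewrite /cabs /= expr0n /= add0r expr1n sqrtr1. Qed.

Lemma cabs_iiM j q : cabs (ii ^+ j * q) = cabs q.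
Proof. by rewrite cabsM cabsX cabs_ii expr1n mul1r. Qed.

(** Serves the points where [|w|] is too small for superharmonicity; there only the total modulus of
    the peaks matters. *)
Lemma avg_pot_ub e w qs (K : R) :
  (forall w', cabs (w' - w) <= \sum_(q <- qs) cabs q -> pot e w' <= K) ->
  avg_pot e w qs <= K.
Proof.
elim: qs w => [|q qs IH] w H /=; first by apply: H; rewrite subrr cabs0 big_nil.
rewrite ler_pdivrMr // (_ : K * 4 = \sum_(j < 4) K); last first.
  by rewrite sumr_const card_ord mulr_natr.
apply: ler_sum => j _; apply: IH => w' w'j; apply: H; rewrite big_cons.
rewrite -[w' - w](subrKA (w + ii ^+ j * q)) addrC; apply: le_trans (cabsD _ _) _.
by rewrite addrAC subrr add0r cabs_iiM lerD2l.
Qed.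

(** Each four-point mean gains a quarter of the term in [pot_sum4]. The two bounds on [|w|] leave
    room for all remaining peaks, so no partial sum falls below the truncation level [t] or exceeds
    [M]. *)
Lemma avg_pot_le (t a M : R) w qs : 0 < t -> 8 * a ^+ 2 * (1 + t ^+ 2) ^+ 2 <= (t ^+ 2) ^+ 2 ->
  \sum_(q <- qs) cabs q <= a ->
  t + \sum_(q <- qs) cabs q <= cabs w -> cabs w + \sum_(q <- qs) cabs q <= M ->
  avg_pot (t ^+ 2) w qs <=
  pot (t ^+ 2) w - (\sum_(q <- qs) cabs q ^+ 2) / (4 * (1 + M ^+ 2) ^+ 2).
Proof.
move=> t0 at2; have e0 : 0 < t ^+ 2 by rewrite exprn_gt0.
elim: qs w => [|q qs IH] w /=.
  by rewrite !big_nil mul0r subr0.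
rewrite !big_cons; set S := \sum_(q <- qs) cabs q; set S2 := \sum_(q <- qs) _.
have S0 : 0 <= S by apply: sumr_ge0 => i _; exact: cabs_ge0.
have q0 := cabs_ge0 q; have w0 := cabs_ge0 w.
set c := (4 * (1 + M ^+ 2) ^+ 2)^-1.
move=> ha hw hM.
have jge (j : nat) : t + S <= cabs (w + ii ^+ j * q).
  have := cabs_sub_ge w (- (ii ^+ j * q)); rewrite opprK cabsN cabs_iiM; lra.
have jle (j : nat) : cabs (w + ii ^+ j * q) + S <= M.
  have := cabsD w (ii ^+ j * q); rewrite cabs_iiM; lra.
have h1 : \sum_(j < 4) avg_pot (t ^+ 2) (w + ii ^+ j * q) qs <=
    \sum_(j < 4) pot (t ^+ 2) (w + ii ^+ j * q) - 4 * (S2 * c).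
  have -> : 4 * (S2 * c) = \sum_(j < 4) (S2 * c).
    by rewrite sumr_const card_ord mulr_natl.
  rewrite -sumrB; apply: ler_sum => j _; have := jge j; have := jle j => ? ?; apply: IH => //; rewrite -/S; lra.
have h2 : \sum_(j < 4) pot (t ^+ 2) (w + ii ^+ j * q) <=
    4 * pot (t ^+ 2) w - cabs q ^+ 2 / (1 + cabs w ^+ 2) ^+ 2.
  apply: pot_sum4 => //.
  - by rewrite ler_pXn2r ?nnegrE ?(ltW t0) //; lra.
  - apply: le_trans at2; rewrite ler_wpM2r ?sqr_ge0 // ler_pM2l //.
    by rewrite ler_pXn2r ?nnegrE //; lra.
  - by move=> j; rewrite ler_pXn2r ?nnegrE ?cabs_ge0 ?(ltW t0) //; have := jge j; lra.
have h3 : cabs q ^+ 2 * (4 * c) <= cabs q ^+ 2 / (1 + cabs w ^+ 2) ^+ 2.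
  rewrite ler_wpM2l ?sqr_ge0 // /c invfM mulrA divff // mul1r.
  have p0 : 0 < 1 + cabs w ^+ 2 by rewrite ltr_pwDl ?sqr_ge0.
  have wM : cabs w ^+ 2 <= M ^+ 2 by rewrite ler_pXn2r ?nnegrE //; lra.
  rewrite lef_pV2 ?posrE ?exprn_gt0 //; last by lra.
  by rewrite ler_pXn2r ?nnegrE //; lra.
rewrite ler_pdivrMr // mulrDl; lra.
Qed.

End averaged_potential.

(** * Continuous functions on the sphere *)

Section cont_sphere_closure.
Context {R : realType} {N : nat}.
Implicit Types (h : 'rV[Cplx R]_N -> R) (w : 'rV[Cplx R]_N -> Cplx R).

Lemma cont_sphere_bounded h : cont_sphere h ->
  exists B : R, forall x, enorm x = 1 -> `|h x| <= B.
Proof.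
move=> hc; have : ccont_sphere (fun x => cofr (h x)).
  move=> x x1 e e0; have [r r0 rP] := hc x x1 e e0; exists r => // y y1 yx.
  have -> : cofr (h y) - cofr (h x) = cofr (h y - h x).
    by apply/eqP; rewrite eq_complex /= oppr0 addr0 !eqxx.
  by rewrite cabs_cofr rP.
move=> /ccont_sphere_bounded[B BP]; exists B => x x1.
by have := BP x x1; rewrite cabs_cofr.
Qed.

Lemma cont_sphere_cst (c : R) : @cont_sphere R N (fun=> c).
Proof. by move=> x x1 e e0; exists 1 => // y _ _; rewrite subrr normr0. Qed.

Lemma cont_sphereD h1 h2 : cont_sphere h1 -> cont_sphere h2 ->
  cont_sphere (fun z => h1 z + h2 z).
Proof.
move=> fc gc x x1 e e0; have e2 : 0 < e / 2 by rewrite divr_gt0.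
have [r r0 rP] := fc x x1 _ e2; have [s s0 sP] := gc x x1 _ e2.
exists (Num.min r s); first by rewrite lt_min r0.
move=> y y1; rewrite lt_min => /andP[yr ys].
rewrite opprD addrACA; apply: le_lt_trans (ler_normD _ _) _.
have := rP y y1 yr; have := sP y y1 ys; lra.
Qed.

Lemma cont_sphereZ (c : R) h : cont_sphere h -> cont_sphere (fun z => h z * c).
Proof.
move=> hc x x1 e e0; have c1 : 0 < `|c| + 1 by rewrite ltr_wpDl.
have [r r0 rP] := hc x x1 _ (divr_gt0 e0 c1); exists r => // y y1 /(rP y y1).
rewrite -mulrBl normrM ltr_pdivlMr //; apply: le_lt_trans.
by rewrite ler_wpM2l // lerDl.
Qed.

Lemma cont_sphere_sum (I : Type) (s : seq I) (F : I -> 'rV[Cplx R]_N -> R) :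
  (forall i, cont_sphere (F i)) -> cont_sphere (fun z => \sum_(i <- s) F i z).
Proof.
move=> FP; elim: s => [|a s IH].
  rewrite (_ : (fun z => _) = fun=> 0); first exact: cont_sphere_cst.
  by apply/funext => z; rewrite big_nil.
rewrite (_ : (fun z => _) = fun z => F a z + \sum_(i <- s) F i z).
  exact: cont_sphereD.
by apply/funext => z; rewrite big_cons.
Qed.

Lemma ccont_sphereZ (c : Cplx R) w : ccont_sphere w -> ccont_sphere (fun z => c * w z).
Proof.
move=> hc x x1 e e0; have c1 : 0 < cabs c + 1 by rewrite ltr_wpDl ?cabs_ge0.
have [r r0 rP] := hc x x1 _ (divr_gt0 e0 c1); exists r => // y y1 /(rP y y1).
rewrite -mulrBr cabsM ltr_pdivlMr // mulrC; apply: le_lt_trans.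
by rewrite ler_wpM2r ?cabs_ge0 // lerDl.
Qed.

Lemma cont_sphere_cabs w : ccont_sphere w -> cont_sphere (fun z => cabs (w z)).
Proof.
move=> wc x x1 e e0; have [r r0 rP] := wc x x1 e e0; exists r => // y y1 yx.
apply: le_lt_trans (rP y y1 yx); rewrite ler_norml lerNl opprB cabs_sub_ge andbT.
by rewrite cabs_distC cabs_sub_ge.
Qed.

Lemma cont_sphere_pot (e : R) w : 0 < e -> ccont_sphere w ->
  cont_sphere (fun z => pot e (w z)).
Proof.
move=> e0 wc x x1 d d0.
(* Covers [pot_lip] in both directions: once [w y] is within [1] of [w x],
   [|w y - w x| + 2 |w y| <= 3 + 2 |w x|]. *)
pose K := 2 * (3 + cabs (w x) *+ 2).
have K0 : 0 < K by rewrite mulr_gt0 // ltr_pwDl // mulrn_wge0 ?cabs_ge0.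
have dK : 0 < Num.min 1 (d * e / K) by rewrite lt_min ltr01 divr_gt0 // mulr_gt0.
have [r r0 rP] := wc x x1 _ dK; exists r => // y y1 /(rP y y1).
rewrite lt_min => /andP[h1 h2].
have wyx : cabs (w y) <= cabs (w x) + 1 by have := cabs_sub_ge (w y) (w x); lra.
have c0 := cabs_ge0 (w y - w x); have cx0 := cabs_ge0 (w x); have cy0 := cabs_ge0 (w y).
have dE : cabs (w y - w x) * K / e < d.
  by rewrite ltr_pdivrMr // -ltr_pdivlMr.
have p1 := pot_lip e (w x) (w y) e0; have p2 := pot_lip e (w y) (w x) e0.
have b1 : 2 * (cabs (w y - w x) * (cabs (w y - w x) + cabs (w x) *+ 2)) / e
    <= cabs (w y - w x) * K / e.
  rewrite ler_wpM2r ?invr_ge0 ?(ltW e0) // /K mulrCA ler_wpM2l //; lra.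
have b2 : 2 * (cabs (w x - w y) * (cabs (w x - w y) + cabs (w y) *+ 2)) / e
    <= cabs (w y - w x) * K / e.
  rewrite cabs_distC ler_wpM2r ?invr_ge0 ?(ltW e0) // /K mulrCA ler_wpM2l //; lra.
rewrite ltr_norml; apply/andP; split; lra.
Qed.

Lemma cont_sphere_avg_pot (I : Type) (e : R) (Z : seq I) (q : I -> 'rV[Cplx R]_N -> Cplx R) w :
  0 < e -> (forall i, ccont_sphere (q i)) -> ccont_sphere w ->
  cont_sphere (fun z => avg_pot e (w z) [seq q i z | i <- Z]).
Proof.
move=> e0 qc; elim: Z w => [|i Z IH] w wc /=; first exact: cont_sphere_pot.
apply: cont_sphereZ; apply: cont_sphere_sum => j.
by apply: (IH (fun z => w z + ii ^+ j * q i z)); apply: ccont_sphereD => //; exact: ccont_sphereZ.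
Qed.

End cont_sphere_closure.

(** * Integration over the sphere *)

Section sphere_integral.
Context {R : realType} {N : nat}.
Let Om := (N + N).-tuple (measurableTypeR R).
Variable mu : {measure set Om -> \bar R}.
Hypothesis mu_fin : (mu punctured_ball < +oo)%E.
Implicit Types (h : 'rV[Cplx R]_N -> R) (w : 'rV[Cplx R]_N -> Cplx R).

Definition cone (A : set 'rV[Cplx R]_N) : set Om :=
  punctured_ball `&` [set t | A (sproj (tuple_to_cvec t))].

(** Surface integral in polar coordinates, left unnormalised: the constant [1] integrates to the
    volume of the punctured ball. *)
Definition sint h : R := (\int[mu]_(t in punctured_ball) h (sproj (tuple_to_cvec t)))%R.

Let mB : measurable (@punctured_ball R N) := measurable_punctured_ball.

Let sproj1 (t : Om) : punctured_ball t -> enorm (sproj (tuple_to_cvec t)) = 1.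
Proof. by move=> /andP[t0 _]; rewrite enorm_sproj // gt_eqF. Qed.

Lemma sint_integrable h : cont_sphere h ->
  mu.-integrable punctured_ball (EFin \o (fun t => h (sproj (tuple_to_cvec t)))).
Proof.
move=> hc; apply: measurable_bounded_integrable => //; first exact: measurable_fun_sproj.
have [B BP] := cont_sphere_bounded _ hc.
exists B; split; first exact: num_real.
by move=> M BM t tB /=; apply: le_trans (ltW BM); apply: BP; exact: sproj1.
Qed.

Lemma sint_sum4 (F : 'I_4 -> 'rV[Cplx R]_N -> R) : (forall j, cont_sphere (F j)) ->
  sint (fun z => (\sum_(j < 4) F j z) / 4) = (\sum_(j < 4) sint (F j)) / 4.
Proof.
move=> Fc; rewrite /sint RintegralZr //; last first.
  by apply: (sint_integrable (fun z => \sum_(j < 4) F j z)); exact: cont_sphere_sum.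
congr (_ / _); elim: (index_enum _) => [|j s IH].
  rewrite big_nil; under eq_Rintegral do rewrite big_nil.
  by rewrite Rintegral_cst // mul0r.
rewrite big_cons -IH -RintegralD //.
- by apply: eq_Rintegral => t _; rewrite big_cons.
- exact: sint_integrable.
- by apply: (sint_integrable (fun z => \sum_(j <- s) F j z)); exact: cont_sphere_sum.
Qed.

(** Serves twice: for the decrease of the potential in one step, and, with [h1 = 0] and [eta = 0],
    as Markov's inequality. *)
Lemma sint_le_indic h1 h2 (G : set 'rV[Cplx R]_N) (k eta : R) :
  cont_sphere h1 -> cont_sphere h2 -> measurable (cone G) -> 0 <= k ->
  (forall z, enorm z = 1 -> h1 z <= h2 z + eta) ->
  (forall z, enorm z = 1 -> G z -> h1 z + k <= h2 z + eta) ->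
  sint h1 + k * fine (mu (cone G)) <= sint h2 + eta * fine (mu punctured_ball).
Proof.
move=> h1c h2c mG k0 H1 H2.
have ic : mu.-integrable punctured_ball (EFin \o (\1_(cone G) : Om -> R)).
  apply: measurable_bounded_integrable => //.
  exists 1; split=> // M M1 t _ /=; apply: le_trans (ltW M1).
  by rewrite indicE; case: (_ \in _); rewrite /= ?normr1 ?normr0.
have e1 : sint h1 + k * fine (mu (cone G)) =
    (\int[mu]_(t in punctured_ball) (h1 (sproj (tuple_to_cvec t)) + k * \1_(cone G) t))%R.
  rewrite RintegralD //; [|exact: sint_integrable|].
    congr (_ + _); rewrite RintegralZl //; congr (_ * _).
    rewrite /Rintegral integral_indic // (_ : cone G `&` _ = cone G) //.
    by apply/setIidPl; exact: subIsetl.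
  rewrite (_ : EFin \o _ = (fun t => k%:E * (EFin \o (\1_(cone G) : Om -> R)) t)%E).
    exact: integrableZl.
  by apply/funext => t /=; rewrite EFinM.
have e2 : sint h2 + eta * fine (mu punctured_ball) =
    (\int[mu]_(t in punctured_ball) (h2 (sproj (tuple_to_cvec t)) + eta))%R.
  rewrite RintegralD //; [|exact: sint_integrable|].
    by rewrite Rintegral_cst.
  exact: (sint_integrable (fun=> eta) (cont_sphere_cst eta)).
rewrite e1 e2; apply: le_Rintegral => //.
- rewrite (_ : EFin \o _ = ((EFin \o (fun t => h1 (sproj (tuple_to_cvec t)))) \+
    (fun t => k%:E * (EFin \o (\1_(cone G) : Om -> R)) t))%E).
    by apply: integrableD => //; [exact: sint_integrable|exact: integrableZl].
  by apply/funext => t /=; rewrite EFinD EFinM.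
- apply: (sint_integrable (fun z => h2 z + eta)); apply: cont_sphereD => //.
  exact: cont_sphere_cst.
- move=> t tB; rewrite indicE; case: (boolP (t \in cone G)) => tG.
    by rewrite mulr1; apply: H2; [exact: sproj1|move: tG; rewrite inE => -[]].
  by rewrite mulr0 addr0; apply: H1; exact: sproj1.
Qed.

Lemma sint_ge0 h : (forall z, enorm z = 1 -> 0 <= h z) -> 0 <= sint h.
Proof. by move=> h0; apply: Rintegral_ge0 => t tB; apply: h0; exact: sproj1. Qed.

(** Phases are fixed one peak at a time: among the four values of the current one, some integral is
    at most their mean, the later phases being still averaged. *)
Lemma phase_selection (I : Type) (e : R) (Z : seq I)
    (q : I -> 'rV[Cplx R]_N -> Cplx R) w :
  0 < e -> (forall i, ccont_sphere (q i)) -> ccont_sphere w ->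
  exists cs : seq nat, size cs = size Z /\
    sint (fun z => pot e (w z + \sum_(p <- zip Z cs) ii ^+ p.2 * q p.1 z)) <=
    sint (fun z => avg_pot e (w z) [seq q i z | i <- Z]).
Proof.
move=> e0 qc; elim: Z w => [|i Z IH] w wc.
  exists [::]; split=> //=; rewrite (_ : (fun z => _) = (fun z => pot e (w z))) //.
  by apply/funext => z; rewrite big_nil addr0.
pose F (j : 'I_4) z := avg_pot e (w z + ii ^+ j * q i z) [seq q i z | i <- Z].
have wj (j : 'I_4) : ccont_sphere (fun z => w z + ii ^+ j * q i z).
  by apply: ccont_sphereD => //; exact: ccont_sphereZ.
have Fc j : cont_sphere (F j) by exact: (cont_sphere_avg_pot _ _ _ _ (fun z => w z + ii ^+ j * q i z)).
have [j jP] : exists j, sint (F j) <= (\sum_(j < 4) sint (F j)) / 4.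
  apply: contrapT => /forallNP H.
  have : \sum_(j < 4) ((\sum_(j < 4) sint (F j)) / 4) < \sum_(j < 4) sint (F j).
    apply: ltr_sum => [|j _]; first by apply/hasP; exists ord0 => //; rewrite mem_index_enum.
    by rewrite ltNge; apply/negP; exact: H.
  by rewrite sumr_const card_ord -[_ *+ 4]mulr_natr divfK // ltxx.
have [cs [sz csP]] := IH _ (wj j).
exists (val j :: cs); split; first by rewrite /= sz.
rewrite [X in _ <= X](_ : _ = (\sum_(j < 4) sint (F j)) / 4); last exact: sint_sum4.
apply: le_trans jP; apply: le_trans csP.
rewrite (_ : (fun z => _) = (fun z => pot e (w z + ii ^+ j * q i z +
  \sum_(p <- zip Z cs) ii ^+ p.2 * q p.1 z))) //.
by apply/funext => z; rewrite /= big_cons /= addrA.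
Qed.

End sphere_integral.

(** * One step of the construction *)

(** In [1 - x^k = (1 - x)(1 + x + ... + x^(k-1))] each of the [k] powers is at least [x^k]. *)
Lemma mul_expr_le_onem {R : realType} (x : R) k : 0 <= x <= 1 ->
  (1 - x) * (k%:R * x ^+ k) <= 1 - x ^+ k.
Proof.
move=> /andP[x0 x1]; elim: k => [|k IH]; first by rewrite mul0r mulr0 expr0 subrr.
have xk0 : 0 <= x ^+ k by rewrite exprn_ge0.
have xk1 : x ^+ k <= 1 by rewrite exprn_ile1.
rewrite -natr1 exprS.
have h : x * ((1 - x) * (k%:R * x ^+ k)) <= x * (1 - x ^+ k) by rewrite ler_wpM2l.
have h2 : (1 - x) * (x * x ^+ k) <= (1 - x) * 1.
  by rewrite ler_wpM2l ?subr_ge0 // mulr_ile1.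
move: h h2; move: (x ^+ k) (k%:R : R) => y c; lra.
Qed.

(* The right-hand sides telescope along a sequence of degrees that at least
   double, which bounds the Bloch norm of a sum independently of its length. *)
Lemma lacunary_le {R : realType} (x : R) n m : 0 <= x <= 1 -> (2 * n <= m)%N ->
  (1 - x) * (m%:R * x ^+ m) <= 2 * (x ^+ n - x ^+ m).
Proof.
move=> x01 nm; have /andP[x0 x1] := x01.
have [k mk] : exists k, m = (n + k)%N by exists (m - n)%N; lia.
have nk : (n <= k)%N by lia.
have := mul_expr_le_onem x k x01.
have xn0 : 0 <= x ^+ n by rewrite exprn_ge0.
have xk0 : 0 <= x ^+ k by rewrite exprn_ge0.
rewrite mk exprD => h.
have h1 := ler_wpM2l xn0 h.
have h2 : (n + k)%:R <= 2 * k%:R :> R by rewrite -natrM ler_nat; lia.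
have h3 : (1 - x) * (x ^+ n * x ^+ k) * (n + k)%:R <= (1 - x) * (x ^+ n * x ^+ k) * (2 * k%:R).
  by rewrite ler_wpM2l // !mulr_ge0 // subr_ge0.
move: h1 h3; move: (x ^+ n) (x ^+ k) => y z; move: ((n + k)%:R : R) (k%:R : R) => c d; lra.
Qed.

Section phase_sums.
Context {R : realType} {N : nat}.
Implicit Types (z : 'rV[Cplx R]_N).

Lemma cabs_phase_sum (I : Type) (Z : seq I) (cs : seq nat) (F : I -> Cplx R) :
  size cs = size Z ->
  cabs (\sum_(p <- zip Z cs) ii ^+ p.2 * F p.1) <= \sum_(i <- Z) cabs (F i).
Proof.
move=> sz; apply: le_trans (cabs_sum _ _ _) _.
rewrite -[X in _ <= \sum_(i <- X) _](@unzip1_zip _ _ Z cs) ?sz // big_map.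
by apply: ler_sum => p _; rewrite cabs_iiM.
Qed.

Lemma rad_diff_sum (I : Type) (s : seq I) (F : I -> 'rV[Cplx R]_N -> Cplx R)
    (D : I -> Cplx R) z : (forall i, rad_diff (F i) (D i) z) ->
  rad_diff (fun z => \sum_(i <- s) F i z) (\sum_(i <- s) D i) z.
Proof.
move=> FD; elim: s => [|i s IH].
  rewrite (_ : (fun z => _) = cst 0) ?big_nil; first exact: rad_diff_cst.
  by apply/funext => y; rewrite big_nil.
rewrite (_ : (fun z => _) = fun z => F i z + \sum_(i <- s) F i z).
  by rewrite big_cons; exact: rad_diffD.
by apply/funext => y; rewrite big_cons.
Qed.

Lemma rad_diffZ (c : Cplx R) f a z : rad_diff f a z ->
  rad_diff (fun z : 'rV[Cplx R]_N => c * f z) (c * a) z.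
Proof.
move=> fa; have := rad_diffM _ _ _ _ _ (rad_diff_cst c z) fa.
by rewrite mulr0 addr0.
Qed.

End phase_sums.

Section block.
Context {R : realType} {N : nat}.
Let Om := (N + N).-tuple (measurableTypeR R).
Variable mu : {measure set Om -> \bar R}.
Hypothesis mu_fin : (mu punctured_ball < +oo)%E.
Hypothesis N0 : (0 < N)%N.

Lemma measurable_cone_annulus (w : 'rV[Cplx R]_N -> Cplx R) (a b : R) :
  ccont_sphere w -> measurable (cone [set z | a <= cabs (w z) <= b]).
Proof.
move=> /cont_sphere_cabs wc.
rewrite (_ : cone _ = (punctured_ball `&` [set t | cabs (w (sproj (tuple_to_cvec t))) <= b])
  `&` (punctured_ball `&` [set t | cabs (w (sproj (tuple_to_cvec t))) * (-1) <= - a])).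
  apply: measurableI; first exact: (measurable_sproj_le _ _ wc).
  exact: (measurable_sproj_le _ _ (cont_sphereZ (-1) _ wc)).
apply/seteqP; split=> t /=.
  by move=> [tB /andP[h1 h2]]; split; split=> //=; rewrite mulrN1 lerN2.
by move=> [[tB h1] [_ /=]]; rewrite mulrN1 lerN2 => h2; split=> //; apply/andP.
Qed.

(* [k1] is a lower bound for the decrease of the averaged potential; it does not
   depend on [w] or on the degree, so finitely many steps suffice.  The term [eta]
   accounts for the points where [|w| < 2 t], reached only by tails of peaks. *)
Lemma block_step (t b0 : R) (B : R) (M k1 eta : R) (w : 'rV[Cplx R]_N -> Cplx R) (n0 : nat) :
  0 < B ->
  (forall m : nat, (0 < m)%N -> exists Z : seq 'rV[Cplx R]_N,
    [/\ forall w, w \in Z -> enorm w = 1,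
        forall z, enorm z = 1 -> exists2 w, w \in Z &
          enorm (z - w) ^+ 2 <= (N + N)%:R / m%:R ^+ 2 &
        forall z, enorm z = 1 ->
          \sum_(w <- Z) expR (- (40 * (8 * N)%:R ^+ 2)^-1 * m%:R ^+ 2 * enorm (z - w) ^+ 2) <= B]) ->
  0 < t <= 4^-1 -> 0 < b0 <= t -> 8 * b0 ^+ 2 * (1 + t ^+ 2) ^+ 2 <= (t ^+ 2) ^+ 2 ->
  0 <= M -> 0 < eta -> k1 = (b0 / B) ^+ 2 / 2 / (4 * (1 + (M + t) ^+ 2) ^+ 2) ->
  ccont_sphere w ->
  exists (n : nat) (P Q : 'rV[Cplx R]_N -> Cplx R),
    [/\ (n0 <= n)%N, is_poly P, P 0 = 0 /\ forall z, rad_diff P (Q z) z,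
        forall (rho : R) z, 0 <= rho <= 1 -> enorm z = 1 ->
          cabs (Q (cofr rho *: z)) <= 2 * b0 * (n%:R * rho ^+ n) &
        sint mu (fun z => pot (t ^+ 2) (w z + P z)) +
          k1 * fine (mu (cone [set z | 4 * t <= cabs (w z) <= M])) <=
        sint mu (fun z => pot (t ^+ 2) (w z)) + eta * fine (mu punctured_ball)].
Proof.
move=> B0 net /andP[t0 t4] /andP[b00 b0t] b0t2 M0 eta0 k1E wc.
have e0 : 0 < t ^+ 2 by rewrite exprn_gt0.
have [r r0 rP] := ccont_sphere_unif _ wc t t0.
(* Admissible total modulus of the peaks where [|w| < 2 t]: as [4 t <= 1], [pot_lip] then bounds the
   change of potential by [4 sg / t^2 <= eta]. *)
pose sg := Num.min 1 (eta * t ^+ 2 / 4).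
have sg0 : 0 < sg by rewrite lt_min ltr01 divr_gt0 // mulr_gt0.
(* The first term makes Gaussian tails beyond distance [r] sum to at most [sg]; the second makes the
   mesh of the net smaller than [r]. *)
pose X := 40 * b0 / (sg * r ^+ 2) + 1 / r ^+ 2.
pose l := ((Num.trunc X).+1 + n0 + 2)%N.
have r20 : 0 < r ^+ 2 by rewrite exprn_gt0.
have Xl : X <= l%:R ^+ 2.
  have : X <= l%:R.
    apply/ltW/(lt_le_trans (truncnS_gt _)); by rewrite ler_nat /l -addnA leq_addr.
  by move/le_trans; apply; rewrite expr2 ler_peMr // ler1n /l addn2.
have X1 : 40 * b0 / (sg * r ^+ 2) <= l%:R ^+ 2.
  by apply: le_trans Xl; rewrite /X lerDl divr_ge0 // ltW.
have X2 : 1 / r ^+ 2 <= l%:R ^+ 2.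
  by apply: le_trans Xl; rewrite /X lerDr; apply: divr_ge0; apply: mulr_ge0 => //; exact: ltW.
have l0 : (0 < l)%N by rewrite /l addn2.
have l2n : (2 <= l)%N by rewrite /l leq_addl.
have ln0 : (n0 <= l)%N by rewrite /l -addnA addnCA leq_addr.
have [n nl] : exists n, n.+1 = (l * l)%N.
  by exists (l * l).-1; rewrite prednK // muln_gt0 l0.
have nlR : n.+1%:R = l%:R ^+ 2 :> R by rewrite nl natrM expr2.
have n1 : (1 <= n)%N by rewrite -ltnS nl (leq_trans l2n) // leq_pmulr.
have nn0 : (n0 <= n.+1)%N by rewrite nl (leq_trans ln0) // leq_pmulr.
have lR : 0 < l%:R :> R by rewrite ltr0n.
(* Mesh [1/(8 N l)] with [l^2 = n.+1] is what [cabs_peak_ge] needs. *)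
have [Z [Z1 Zd ZB]] := net (l * (8 * N))%N ltac:(by rewrite muln_gt0 l0 muln_gt0).
(* Square root of the Gaussian bounding a peak. In [E^2] one factor yields the tail and the other is
   summed over the net; a single [E] covers the derivative, as [n >= (n+1)/2]. *)
pose E (z u : 'rV[Cplx R]_N) : R := expR (- (l%:R ^+ 2 / 40 * enorm (z - u) ^+ 2)).
have {}ZB z : enorm z = 1 -> \sum_(u <- Z) E z u <= B.
  move=> z1; apply: le_trans (ZB z z1); rewrite le_eqVlt; apply/orP; left; apply/eqP.
  apply: eq_bigr => u _; congr expR; rewrite !natrM.
  have NR : (N%:R : R) != 0 by rewrite pnatr_eq0 -lt0n.
  by field.
have {}Zd z : enorm z = 1 -> exists2 u, u \in Z & enorm (z - u) ^+ 2 <= (4 * n.+1%:R)^-1.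
  move=> z1; have [u uZ h] := Zd z z1; exists u => //; apply: le_trans h _.
  rewrite nlR natrM exprMn natrM.
  have N1 : 1 <= N%:R :> R by rewrite ler1n.
  have NR : 0 < N%:R :> R by rewrite ltr0n.
  have l2 : 0 < l%:R ^+ 2 :> R by rewrite exprn_gt0.
  rewrite ler_pdivrMr ?mulr_gt0 ?exprn_gt0 ?mulr_gt0 // mulrC ler_pdivlMr ?mulr_gt0 //.
  rewrite natrD; move: (l%:R ^+ 2 : R) l2 => L2 L20.
  have -> : (N%:R + N%:R) * (4 * L2) = L2 * (8 * N%:R) by ring.
  rewrite ler_pM2l //; nra.
have E0 z u : 0 <= E z u by exact: expR_ge0.
have E1 z u : E z u <= 1.
  by rewrite -expR0 ler_expR oppr_le0 mulr_ge0 ?sqr_ge0 // divr_ge0 ?sqr_ge0.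
have EE z u : expR (- enorm (z - u) ^+ 2 / 20) ^+ n.+1 = E z u ^+ 2.
  by rewrite -!expRM_natl nlR; congr expR; field.
have En z u : expR (- enorm (z - u) ^+ 2 / 20) ^+ n <= E z u.
  rewrite -expRM_natl ler_expR -nlR -[n.+1%:R]natr1.
  have : 0 <= (n%:R - 1) * enorm (z - u) ^+ 2.
    by rewrite mulr_ge0 ?sqr_ge0 // subr_ge0 ler1n.
  move: (enorm _ ^+ 2) => d2; lra.
(* The amplitude of each peak, such that the moduli of a block sum to at most [a B = b0]. *)
have [a aE] : exists a, a = b0 / B by eexists.
rewrite -aE in k1E; have a0 : 0 < a by rewrite aE divr_gt0.
have aB : a * B = b0 by rewrite aE divfK // gt_eqF.
pose q (u z : 'rV[Cplx R]_N) : Cplx R := cofr a * peak n u z.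
(* The level [3 t] is one oscillation [t] away from [2 t] and [4 t]: points with [|w| < 2 t] are at
   distance at least [r] from [Zg], and net points near [|w| >= 4 t] belong to it. *)
pose Zg := [seq u <- Z | 3 * t <= cabs (w u)].
have Zg1 u : u \in Zg -> enorm u = 1 by rewrite mem_filter => /andP[_ /Z1].
have q_le u z : u \in Zg -> enorm z = 1 -> cabs (q u z) <= a * E z u ^+ 2.
  move=> /Zg1 u1 z1; rewrite cabsM cabs_cofr_ge0 ?(ltW a0) // ler_pM2l // -EE.
  have := cabs_peak_le 1 n z u ltac:(by rewrite ler01 lexx) z1 u1.
  by rewrite -[cofr 1]/(1 : Cplx R) scale1r expr1n mul1r.
have q_le1 u z : u \in Zg -> enorm z = 1 -> cabs (q u z) <= a * E z u.
  move=> uZ z1; apply: le_trans (q_le _ _ uZ z1) _.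
  by rewrite ler_pM2l // expr2 ler_piMr.
have ZgB z : enorm z = 1 -> \sum_(u <- Zg) E z u <= B.
  move=> z1; apply: le_trans (ZB z z1); rewrite big_filter big_mkcond /=.
  by apply: ler_sum => u _; case: ifP.
have S_le z : enorm z = 1 -> \sum_(u <- Zg) cabs (q u z) <= b0.
  move=> z1; rewrite -aB; apply: (@le_trans _ _ (\sum_(u <- Zg) a * E z u)).
    by rewrite big_seq_cond [leRHS]big_seq_cond; apply: ler_sum => u /andP[uZ _]; exact: q_le1.
  by rewrite -mulr_sumr ler_pM2l // ZgB.
have qc u : ccont_sphere (q u).
  by apply: ccont_sphereZ; apply: is_poly_ccont_sphere; exact: is_poly_peak.
have [cs [sz csP]] := phase_selection mu mu_fin _ (t ^+ 2) Zg q w e0 qc wc.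
exists n.+1, (fun z => \sum_(p <- zip Zg cs) ii ^+ p.2 * q p.1 z),
  (fun z => \sum_(p <- zip Zg cs) ii ^+ p.2 * (cofr a * peak_rad n p.1 z)).
split=> //.
- apply: (is_poly_sum _ _ (fun p z => ii ^+ p.2 * q p.1 z)) => p.
  apply: (is_polyM (fun=> ii ^+ p.2)); first exact: is_poly_cst.
  apply: (is_polyM (fun=> cofr a)); [exact: is_poly_cst|exact: is_poly_peak].
- split=> [|z].
    rewrite big1 // => p _; rewrite /q /peak.
    rewrite (_ : inner 0 p.1 = 0) ?mul0r ?expr0n ?mulr0 //.
    by rewrite /inner big1 // => k _; rewrite mxE mul0r.
  apply: rad_diff_sum => p; apply: rad_diffZ; apply: rad_diffZ; exact: rad_diff_peak.
- move=> rho z r01 z1.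
  apply: le_trans (cabs_phase_sum _ _ _ (fun u => cofr a * peak_rad n u (cofr rho *: z)) sz) _.
  have /andP[rho0 rho1] := r01.
  apply: (@le_trans _ _ (\sum_(u <- Zg) (2 * a * (n.+1%:R * rho ^+ n.+1)) * E z u)).
    rewrite big_seq_cond [leRHS]big_seq_cond; apply: ler_sum => u /andP[/Zg1 u1 _].
    rewrite cabsM cabs_cofr_ge0 ?(ltW a0) // [2 * a]mulrC -!mulrA ler_pM2l //.
    apply: le_trans (cabs_peak_rad_le _ n _ _ r01 z1 u1) _.
    by rewrite !mulrA ler_wpM2l ?En // !mulr_ge0 ?exprn_ge0.
  rewrite -mulr_sumr -aB.
  have h : 0 <= 2 * a * (n.+1%:R * rho ^+ n.+1) by rewrite !mulr_ge0 ?exprn_ge0 ?(ltW a0).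
  have := ler_wpM2l h (ZgB z z1); move: (\sum_(u <- Zg) _) => s; lra.
apply: (@le_trans _ _ (sint mu (fun z => avg_pot (t ^+ 2) (w z) [seq q i z | i <- Zg]) +
  k1 * fine (mu (cone [set z | 4 * t <= cabs (w z) <= M])))).
  by rewrite lerD2r.
have q2_ge0 : 0 <= a ^+ 2 / 2 by rewrite divr_ge0 ?sqr_ge0.
(* [M'] stays free: outside the annulus [|w|] has no uniform bound and [M' = |w z|] is taken, only
   to discard the gain. *)
have avg_le z : enorm z = 1 -> 2 * t <= cabs (w z) -> forall M', cabs (w z) <= M' ->
    avg_pot (t ^+ 2) (w z) [seq q i z | i <- Zg] <= pot (t ^+ 2) (w z) -
      (\sum_(u <- Zg) cabs (q u z) ^+ 2) / (4 * (1 + (M' + t) ^+ 2) ^+ 2).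
  move=> z1 wt M' wM'.
  have := avg_pot_le t b0 (M' + t) (w z) [seq q i z | i <- Zg] t0 b0t2.
  rewrite !big_map; apply; have := S_le z z1; lra.
apply: sint_le_indic => //.
- exact: cont_sphere_avg_pot.
- exact: cont_sphere_pot.
- exact: measurable_cone_annulus.
- by rewrite k1E divr_ge0 // mulr_ge0 // sqr_ge0.
- move=> z z1; have [wt|wt] := ltP (cabs (w z)) (2 * t); last first.
    apply: le_trans (avg_le z z1 wt _ (lexx _)) _.
    apply: (@le_trans _ _ (pot (t ^+ 2) (w z))); last by rewrite lerDl ltW.
    rewrite gerBl divr_ge0 //; first by apply: sumr_ge0 => u _; exact: sqr_ge0.
    by rewrite mulr_ge0 // sqr_ge0.
  have far u : u \in Zg -> r <= enorm (z - u).
    move=> uZ; rewrite leNgt; apply/negP => zu; have := rP z u z1 (Zg1 u uZ) zu.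
    move: uZ; rewrite mem_filter => /andP[wu _].
    by have := cabs_sub_ge (w u) (w z); rewrite cabs_distC; lra.
  have Ssg : \sum_(u <- Zg) cabs (q u z) <= sg.
    pose tau := expR (- (l%:R ^+ 2 / 40 * r ^+ 2)).
    have tau_le : tau * b0 <= sg.
      have tau0 : 0 < tau by exact: expR_gt0.
      have l2 : 0 < l%:R ^+ 2 / 40 * r ^+ 2 by rewrite mulr_gt0 // divr_gt0 // exprn_gt0.
      have : tau * (l%:R ^+ 2 / 40 * r ^+ 2) <= 1.
        apply: (@le_trans _ _ (tau * expR (l%:R ^+ 2 / 40 * r ^+ 2))).
          rewrite ler_pM2l //; apply: le_trans (expR_ge1Dx _); lra.
        by rewrite /tau -expRD addNr expR0.
      move: X1; rewrite ler_pdivrMr ?mulr_gt0 // => X1 h.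
      have h2 : tau * (40 * b0) <= tau * (l%:R ^+ 2 * (sg * r ^+ 2)) by rewrite ler_pM2l.
      have h3 := ler_wpM2l (ltW sg0) h.
      move: (l%:R ^+ 2) h2 h3 => L2; lra.
    apply: le_trans tau_le; rewrite -aB.
    apply: (@le_trans _ _ (\sum_(u <- Zg) (tau * a) * E z u)).
      rewrite big_seq_cond [leRHS]big_seq_cond; apply: ler_sum => u /andP[uZ _].
      apply: le_trans (q_le u z uZ z1) _.
      rewrite (mulrC tau) -mulrA ler_pM2l // expr2 ler_wpM2r //.
      rewrite ler_expR lerN2 ler_wpM2l ?divr_ge0 ?sqr_ge0 //.
      by rewrite ler_pXn2r ?nnegrE ?enorm_ge0 ?(ltW r0) // far.
    by rewrite -mulr_sumr mulrA ler_wpM2l ?ZgB // mulr_ge0 ?expR_ge0 // ltW.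
  apply: avg_pot_ub => w' ; rewrite big_map => w'w.
  rewrite addrC -lerBlDr; apply: le_trans (pot_lip _ _ _ e0) _.
  rewrite ler_pdivrMr //.
  have w0 := cabs_ge0 (w z); have d0 := cabs_ge0 (w' - w z).
  have ds : cabs (w' - w z) <= sg by exact: le_trans w'w Ssg.
  have s1 : sg <= 1 by rewrite /sg ge_min lexx.
  have s2 : sg <= eta * t ^+ 2 / 4 by rewrite /sg ge_min lexx orbT.
  have : cabs (w' - w z) * (cabs (w' - w z) + cabs (w z) *+ 2) <= sg * 2.
    apply: ler_pM => //; first by rewrite addr_ge0 // mulrn_wge0.
    rewrite mulr2n; lra.
  move: (_ * _) => p; lra.
- move=> z z1 /andP[w4 wM].
  have wt : 2 * t <= cabs (w z) by lra.
  have := avg_le z z1 wt M wM.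
  (* A single nearby net point already provides the uniform gain [a^2/2]. *)
  have [u uZ du] := Zd z z1.
  have ur : enorm (z - u) < r.
    rewrite -(@ltr_pXn2r _ 2) ?nnegrE ?enorm_ge0 ?(ltW r0) //; apply: le_lt_trans du _.
    rewrite nlR invf_plt ?posrE //; last by rewrite mulr_gt0 // exprn_gt0.
    have L2 : 0 < l%:R ^+ 2 :> R by rewrite exprn_gt0.
    rewrite -div1r; lra.
  have uZg : u \in Zg.
    rewrite mem_filter uZ andbT; have := rP z u z1 (Z1 u uZ) ur.
    by have := cabs_sub_ge (w z) (w u); lra.
  have : a ^+ 2 / 2 <= \sum_(u <- Zg) cabs (q u z) ^+ 2.
    rewrite (big_rem u) //=; apply: (@le_trans _ _ (cabs (q u z) ^+ 2)).
      rewrite cabsM cabs_cofr_ge0 ?(ltW a0) // exprMn ler_pM2l ?exprn_gt0 //.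
      exact: cabs_peak_ge (Zg1 u uZg) du.
    by rewrite lerDl; apply: sumr_ge0 => v _; exact: sqr_ge0.
  move=> h1 h2; have c0 : 0 <= (4 * (1 + (M + t) ^+ 2) ^+ 2)^-1.
    by rewrite invr_ge0 mulr_ge0 // sqr_ge0.
  have := ler_wpM2r c0 h1; rewrite -k1E => h3.
  by lra.
Qed.

End block.

(** * Iteration *)

Section iteration.
Context {R : realType} {N : nat}.
Let Om := (N + N).-tuple (measurableTypeR R).
Variable mu : {measure set Om -> \bar R}.
Hypothesis mu_fin : (mu punctured_ball < +oo)%E.
Hypothesis mu_gt0 : (0 < mu punctured_ball)%E.
Hypothesis N0 : (0 < N)%N.

Let V := fine (mu (@punctured_ball R N)).

Lemma fine_cone (A : set 'rV[Cplx R]_N) : measurable (cone A) ->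
  (fine (mu (cone A)))%:E = mu (cone A).
Proof.
move=> mA; rewrite fineK // ge0_fin_numE //; apply: le_lt_trans mu_fin.
apply: le_measure; rewrite ?inE //; first exact: measurable_punctured_ball.
exact: subIsetl.
Qed.

(** By contradiction: without such an [f] the step could be repeated forever, each time lowering the
    nonnegative quantity [J] by the same [st > 0]. *)
Lemma approx_off_small_set (psi : 'rV[Cplx R]_N -> Cplx R) (eps : R) :
  ccont_sphere psi -> 0 < eps ->
  exists (f Df : 'rV[Cplx R]_N -> Cplx R),
    [/\ is_poly f, f 0 = 0 /\ (forall z, rad_diff f (Df z) z),
        forall (rho : R) z, 0 <= rho <= 1 -> enorm z = 1 ->
          (1 - rho) * cabs (Df (cofr rho *: z)) <= eps &
        (1 - eps) * V <= fine (mu (cone [set z | 0 <= cabs (f z - psi z) <= eps]))].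
Proof.
move=> psic eps0.
have V0 : 0 < V by rewrite fine_gt0 // mu_gt0 mu_fin.
pose t := Num.min eps 1 / 4.
have t0 : 0 < t by rewrite divr_gt0 // lt_min eps0 ltr01.
have te : 4 * t <= eps by rewrite /t mulrC divfK // ge_min lexx.
have t4 : t <= 4^-1.
  by rewrite /t -[leRHS]mul1r ler_pM2r ?invr_gt0 // ge_min lexx orbT.
(* Order [t^2] is forced by [pot_sum4], which compares [|q|] with the truncation [e = t^2]. The
   Bloch cost of all blocks together is at most [4 b0]. *)
pose b0 := t ^+ 2 / 8.
have b00 : 0 < b0 by rewrite divr_gt0 // exprn_gt0.
have b0t : b0 <= t by rewrite /b0; nra.
have b04 : 4 * b0 <= eps by rewrite /b0; nra.
have e0 : 0 < t ^+ 2 by rewrite exprn_gt0.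
have b0t2 : 8 * b0 ^+ 2 * (1 + t ^+ 2) ^+ 2 <= (t ^+ 2) ^+ 2.
  rewrite /b0; have t1 : t ^+ 2 <= 1 by nra.
  move: (t ^+ 2) e0 t1 => e e0 e1; have h : (1 + e) ^+ 2 <= 4 by nra.
  have := ler_wpM2l (sqr_ge0 e) h; nra.
have k0 : 0 < (40 * (8 * N)%:R ^+ 2)^-1 :> R.
  by rewrite invr_gt0 mulr_gt0 // exprn_gt0 // ltr0n muln_gt0.
have [B B0 net] := @sphere_net R N _ k0.
pose J (f : 'rV[Cplx R]_N -> Cplx R) := sint mu (fun z => pot (t ^+ 2) (f z - psi z)).
pose J0 := J (fun=> 0).
have J00 : 0 <= J0 by apply: sint_ge0 => z z1; exact: pot_ge0.
(* Markov level: [pot >= K] holds on measure at most [eps V / 2] as long as [J f <= J0]. The [1]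
   only makes [K] positive. *)
pose K := (J0 + 1) / (eps * V / 2).
have eV : 0 < eps * V / 2 by rewrite divr_gt0 // mulr_gt0.
have K0 : 0 < K by rewrite divr_gt0 // ltr_wpDl.
have [M M0 MP] := pot_unbounded (t ^+ 2) K e0.
pose k1 := (b0 / B) ^+ 2 / 2 / (4 * (1 + (M + t) ^+ 2) ^+ 2).
have k10 : 0 < k1.
  rewrite !divr_gt0 ?exprn_gt0 ?divr_gt0 // mulr_gt0 // exprn_gt0 //.
  by rewrite ltr_pwDl // sqr_ge0.
(* Half of the gain guaranteed on the annulus; the error [eta V = st] uses up the other half. *)
pose st := k1 * (eps * V / 2) / 2.
have st0 : 0 < st by rewrite divr_gt0 // mulr_gt0.
pose eta := st / V; have eta0 : 0 < eta by rewrite divr_gt0.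
apply: contrapT => noex.
have wcf f : is_poly f -> ccont_sphere (fun z => f z - psi z).
  by move=> fp; apply: ccont_sphereB => //; exact: is_poly_ccont_sphere.
(* [n] is the exponent of the last block. By [lacunary_le] a new block of exponent [n'] adds at most
   [4 b0 (rho^n - rho^n')], so the bound telescopes. *)
have state (k : nat) : exists (n : nat) (f Df : 'rV[Cplx R]_N -> Cplx R),
    [/\ is_poly f, f 0 = 0 /\ (forall z, rad_diff f (Df z) z),
        forall (rho : R) z, 0 <= rho <= 1 -> enorm z = 1 ->
          (1 - rho) * cabs (Df (cofr rho *: z)) <= 4 * b0 * (1 - rho ^+ n) &
        J f <= J0 - k%:R * st].
  elim: k => [|k [n [f [Df [fp [f0 fD] fB fJ]]]]].
    exists 0%N, (fun=> 0), (fun=> 0); split=> //.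
    - exact: is_poly_cst.
    - by split=> // z; exact: rad_diff_cst.
    - by move=> rho z _ _; rewrite cabs0 expr0 subrr !mulr0.
    - by rewrite mul0r subr0.
  have wc := wcf f fp.
  have [n' [P [Q [nn' Pp [P0 PQ] PB PJ]]]] := block_step mu mu_fin N0 t b0 B M k1 eta
    (fun z => f z - psi z) (2 * n) B0 net ltac:(by rewrite t0) ltac:(by rewrite b00)
    b0t2 (ltW M0) eta0 erefl wc.
  exists n', (fun z => f z + P z), (fun z => Df z + Q z); split.
  - exact: is_polyD.
  - by rewrite f0 P0 addr0; split=> // z; exact: rad_diffD.
  - move=> rho z r01 z1; have /andP[r0 r1] := r01.
    have := fB rho z r01 z1; have := PB rho z r01 z1.
    have := lacunary_le rho n n' r01 nn'.
    have := cabsD (Df (cofr rho *: z)) (Q (cofr rho *: z)).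
    rewrite -subr_ge0 in r1.
    move=> h1 h2 h3 h4; have h5 := ler_wpM2l r1 h1; have h6 := ler_wpM2l r1 h3.
    have h7 := ler_wpM2l (ltW b00) h2.
    by move: h4 h5 h6 h7; move: (cabs _) (cabs _) (cabs _) (rho ^+ n) (rho ^+ n') (n'%:R : R) => *; lra.
  (* Since [4 t <= eps], the sets [|w| <= eps], [4 t <= |w| <= M] and [|w| >= M] cover the sphere.
     The last has measure at most [eps V / 2]; were the second smaller than that, [f] would already
     satisfy the conclusion. *)
  have muG : eps * V / 2 <= fine (mu (cone [set z | 4 * t <= cabs (f z - psi z) <= M])).
    rewrite leNgt; apply/negP => Gsmall; apply: noex; exists f, Df; split=> //.
      move=> rho z r01 z1; apply: le_trans (fB rho z r01 z1) _; apply: le_trans b04.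
      have /andP[r0 r1] := r01; have := exprn_ge0 n r0.
      by move: (rho ^+ n) => y y0; nra.
    have mE := measurable_cone_annulus _ 0 eps wc.
    have mG := measurable_cone_annulus _ (4 * t) M wc.
    pose H : set 'rV[Cplx R]_N := [set z | - (cabs (f z - psi z)) <= - M].
    have mH : measurable (cone H).
      rewrite (_ : cone H = punctured_ball `&` [set s |
          cabs (f (sproj (tuple_to_cvec s)) - psi (sproj (tuple_to_cvec s))) * -1 <= - M]).
        exact: (measurable_sproj_le _ _ (cont_sphereZ (-1) _ (cont_sphere_cabs _ wc))).
      by apply/seteqP; split=> s /= [sB]; rewrite /H /= mulrN1.
    have muH : fine (mu (cone H)) <= eps * V / 2.
      have := sint_le_indic mu mu_fin (fun=> 0) (fun z => pot (t ^+ 2) (f z - psi z)) H K 0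
        (cont_sphere_cst 0) (cont_sphere_pot _ _ e0 wc) mH (ltW K0) _ _.
      rewrite mul0r addr0 => /(_ _)/(_ _) h.
      have {}h : K * fine (mu (cone H)) <= J0 + 1.
        have : sint mu (fun=> 0 : R) + K * fine (mu (cone H)) <= J f.
          apply: h => [z _|z _ Hz]; rewrite ?addr0 ?add0r; first exact: pot_ge0.
          by apply: MP; move: Hz; rewrite /H /= lerN2.
        have : 0 <= sint mu (fun=> 0 : R) by apply: sint_ge0.
        have : 0 <= k%:R * st by rewrite mulr_ge0 // ltW.
        lra.
      by rewrite -(ler_pM2l K0) /K divfK ?gt_eqF // divr_gt0 // mulr_gt0.
    have cover : (mu punctured_ball <= mu (cone [set z | (0 <= cabs (f z - psi z) <= eps)%R])
        + mu (cone [set z | (4 * t <= cabs (f z - psi z) <= M)%R]) + mu (cone H))%E.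
      apply: le_trans (leeD (measureU2 _ mE mG) (lexx _)); apply: le_trans (measureU2 _ _ mH).
        apply: le_measure; rewrite ?inE; [exact: measurable_punctured_ball| |].
          by do 2![apply: measurableU => //].
        move=> s sB; have := cabs_ge0 (f (sproj (tuple_to_cvec s)) - psi (sproj (tuple_to_cvec s))).
        move=> c0; case: (leP (4 * t) (cabs (f (sproj (tuple_to_cvec s)) - psi (sproj (tuple_to_cvec s))))) => c1.
          case: (leP (cabs (f (sproj (tuple_to_cvec s)) - psi (sproj (tuple_to_cvec s)))) M) => c2.
            by left; right; split=> //=; rewrite c1.
          by right; split=> //; rewrite /H /= lerN2 ltW.
        by left; left; split=> //=; rewrite c0 (le_trans (ltW c1)).
      exact: measurableU.
    have : V <= fine (mu (cone [set z | 0 <= cabs (f z - psi z) <= eps])) +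
        fine (mu (cone [set z | 4 * t <= cabs (f z - psi z) <= M])) + fine (mu (cone H)).
      rewrite -lee_fin !EFinD !fine_cone //; apply: le_trans cover.
      by rewrite /V fineK // ge0_fin_numE.
    by lra.
  have {}PJ : J (fun z => f z + P z) + k1 * fine (mu (cone [set z | 4 * t <= cabs (f z - psi z) <= M]))
      <= J f + st.
    move: PJ; rewrite -/V /eta divfK ?gt_eqF //.
    rewrite (_ : (fun z => pot (t ^+ 2) (f z - psi z + P z)) =
      (fun z => pot (t ^+ 2) (f z + P z - psi z))) //.
    by apply/funext => z; rewrite addrAC.
  have : k1 * (eps * V / 2) <= k1 * fine (mu (cone [set z | 4 * t <= cabs (f z - psi z) <= M])).
    by rewrite ler_pM2l.
  have : k1 * (eps * V / 2) = st * 2 by rewrite /st divfK.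
  rewrite -natr1; lra.
have [n [f [Df [fp _ _ fJ]]]] := state (Num.trunc (J0 / st)).+1.
have : 0 <= J f by apply: sint_ge0 => z z1; exact: pot_ge0.
have := truncnS_gt (J0 / st); rewrite ltr_pdivrMr //; lra.
Qed.

End iteration.

(** * Bloch norm estimates and conclusion *)

Section bloch.
Context {R : realType} {N : nat}.
Implicit Types (f u v : 'rV[Cplx R]_N -> Cplx R) (z : 'rV[Cplx R]_N).

(** The factor [2] comes from [1 - |z|^2 = (1 + |z|)(1 - |z|)]. *)
Lemma bloch_normD_le u v Dv (c : R) :
  0 <= c -> holomorphic_on_ball u -> v 0 = 0 -> (forall z, rad_diff v (Dv z) z) ->
  (forall (rho : R) z, 0 <= rho <= 1 -> enorm z = 1 ->
     (1 - rho) * cabs (Dv (cofr rho *: z)) <= c) ->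
  (bloch_norm (fun z => u z + v z)%R <= bloch_norm u + (2 * c)%:E)%E.
Proof.
move=> c0 uh v0 vD vB; rewrite /bloch_norm v0 addr0 -addeA leeD2l //.
apply: ge_ereal_sup => _ [z zB <-].
have [uz DE] := rad_diffD _ _ _ _ _ (conj (uh z zB) erefl) (vD z).
rewrite DE.
have z0 : 0 <= enorm z by exact: enorm_ge0.
have z1 : enorm z < 1 by exact: zB.
have w0 : 0 <= 1 - enorm z ^+ 2 by nra.
have vz : (1 - enorm z ^+ 2) * cabs (Dv z) <= 2 * c.
  (* The origin has no projection to the sphere, but every radial derivative vanishes there. *)
  have [ez|ez] := eqVneq (enorm z) 0.
    have [_ <-] := vD z; rewrite (enorm0_eq0 _ ez) /radial_derivative.
    rewrite big1 ?cabs0 ?mulr0 ?mulr_ge0 // => k _.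
    by rewrite mxE mul0r.
  have := vB (enorm z) (sproj z) ltac:(by rewrite z0 ltW) (enorm_sproj _ ez).
  rewrite sprojK //; have := cabs_ge0 (Dv z); move: (cabs _) => y y0 h.
  have -> : (1 - enorm z ^+ 2) * y = (1 + enorm z) * ((1 - enorm z) * y) by ring.
  apply: le_trans (ler_wpM2l _ h) _; first by rewrite addr_ge0.
  by rewrite ler_wpM2r //; lra.
apply: (@le_trans _ _ ((1 - enorm z ^+ 2) * cabs (radial_derivative u z) + 2 * c)%:E).
  rewrite lee_fin; apply: le_trans (_ : _ <= (1 - enorm z ^+ 2) *
    (cabs (radial_derivative u z) + cabs (Dv z))) _.
    by rewrite ler_wpM2l // cabsD.
  by rewrite mulrDr lerD2l.
by rewrite EFinD leeD2r //; apply: ereal_sup_ubound; exists z.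
Qed.

Lemma bloch_norm0 : bloch_norm (fun _ : 'rV[Cplx R]_N => 0 : Cplx R) = 0%E.
Proof.
have D0 (z : 'rV[Cplx R]_N) : radial_derivative (fun=> 0 : Cplx R) z = 0.
  by have [] := rad_diff_cst (0 : Cplx R) z.
rewrite /bloch_norm cabs0 add0e; apply/eqP; rewrite eq_le; apply/andP; split.
  by apply: ge_ereal_sup => _ [z _ <-]; rewrite D0 cabs0 mulr0.
apply: ereal_sup_ubound; exists 0; last by rewrite D0 cabs0 mulr0.
by rewrite /unit_ball /= enorm0 ltr01.
Qed.

End bloch.

Theorem lemma2p1 (R : realType) (N : nat) (eps : R)
    (L : set 'rV[Cplx R]_N) (g phi : 'rV[Cplx R]_N -> Cplx R)
    (hN : (1 <= N)%N) (heps : 0 < eps)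
    (hLc : compact L) (hLB : L `<=` unit_ball R N)
    (hg : little_bloch g)
    (hphi : {within unit_sphere R N, continuous phi}) :
  exists (E : set 'rV[Cplx R]_N) (f : 'rV[Cplx R]_N -> Cplx R),
    [/\ borel_set E /\ E `<=` unit_sphere R N,
        ((1 - eps)%:E <= sphere_measure E)%E,
        is_poly f /\ little_bloch f,
        (bloch_norm (f \- g)%R < eps%:E)%E
      & (sup_norm_on E (f \- phi)%R < eps%:E)%E].
Proof.
have [[gh gB] gp] := hg.
have eps2 : 0 < eps / 2 by rewrite divr_gt0.
have [p [pP [ph pB] pg]] := gp _ eps2.
pose psi z := phi z - p z.
have psic : ccont_sphere psi.
  by apply: ccont_sphereB; [exact: within_ccont_sphere|exact: is_poly_ccont_sphere].
have [mu [mu0 muoo muE]] := @sphere_measureE R N hN.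
(* The correction [v] costs at most [2 d = eps/4] in Bloch norm, on top of less than [eps/2] for
   [p - g]. *)
pose d := eps / 8; have d0 : 0 < d by rewrite divr_gt0.
have [v [Dv [vP [v0 vD] vB vV]]] := approx_off_small_set mu muoo mu0 hN psi d psic d0.
pose f z := p z + v z.
have fP : is_poly f by exact: is_polyD.
have fpsi z : v z - psi z = f z - phi z by rewrite /psi /f; ring.
have fh : holomorphic_on_ball f.
  by move=> z zB; apply: differentiableD; [exact: ph|exact: (vD z).1].
have fB : bloch f.
  split; first exact: fh.
  apply: le_lt_trans (bloch_normD_le p v Dv d (ltW d0) ph v0 vD vB) _.
  by apply: lte_add_pinfty; [exact: pB|exact: ltry].
pose E : set 'rV[Cplx R]_N := [set z | enorm z = 1 /\ cabs (v z - psi z) <= d].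
have vpc : ccont_sphere (fun z => v z - psi z).
  by apply: ccont_sphereB => //; exact: is_poly_ccont_sphere.
have ES : E `<=` unit_sphere R N by move=> z [].
exists E, f; split.
- by split; [apply: closed_borel; exact: closed_cabs_le|exact: ES].
- have V0 : 0 < fine (mu (@punctured_ball R N)) by rewrite fine_gt0 // mu0 muoo.
  rewrite muE //.
  (* On the punctured ball projections have norm [1], so the sphere condition in [E] is automatic
     there. *)
  rewrite (_ : _ `&` _ = cone [set z | 0 <= cabs (v z - psi z) <= d]); last first.
    apply/seteqP; split=> s /= [sB].
      by move=> [_ h]; split=> //=; rewrite cabs_ge0.
    move=> /andP[_ h]; split=> //; split=> //.
    by rewrite enorm_sproj // gt_eqF //; case/andP: sB.
  rewrite -(fine_cone mu muoo); last exact: measurable_cone_annulus.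
  rewrite -EFinM lee_fin ler_pdivlMr //; apply: le_trans vV.
  by rewrite ler_pM2r // /d; lra.
- split; first exact: fP.
  split; first exact: fB.
  move=> e e0; exists f; split; [exact: fP|exact: fB|].
  rewrite (_ : f \- f = fun=> 0); first by rewrite bloch_norm0 lte_fin.
  by apply/funext => z /=; rewrite subrr.
- rewrite (_ : f \- g = fun z => (p \- g) z + v z); last first.
    by apply/funext => z; rewrite /f /=; ring.
  have pgh : holomorphic_on_ball (p \- g).
    by move=> z zB; apply: differentiableB; [exact: ph|exact: gh].
  apply: le_lt_trans (bloch_normD_le (p \- g) v Dv d (ltW d0) pgh v0 vD vB) _.
  rewrite (_ : eps%:E = (eps / 2)%:E + (eps / 2)%:E)%E; last by rewrite -EFinD -splitr.
  by apply: lte_leD; [by []|exact: pg|rewrite lee_fin /d; lra].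
- apply: (@le_lt_trans _ _ d%:E); last by rewrite lte_fin /d; lra.
  by apply: ge_ereal_sup => _ [z [z1 zd] <-]; rewrite lee_fin /= -fpsi.
Qed.
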